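(* For every nonzero $\lambda\in Q^+_{\mathrm{im}}$, the polynomial $m_\lambda(t)$ equals the coefficient of $e^\lambda$ in the finite product $$\prod_{\substack{0\neq\mu\in Q^+\\ \mathrm{ht}(\mu)<\mathrm{ht}(\lambda)}}\ \prod_{n\ge0}(1-t^ne^\mu)^{m(\mu,n)} .$$ Consequently the integers $m(\lambda,n)$, $0\neq\lambda\in Q^+_{\mathrm{im}}$, $n\ge 0$, and hence $\mathfrak m=\prod_{0\ne\lambda\in Q^+_{\mathrm{im}}}\prod_{n\ge0}(1-t^ne^\lambda)^{-m(\lambda,n)}$, are determined recursively by induction on $\mathrm{ht}(\lambda)$ from the list of positive real roots of $\Phi$.
   Context: Setting. $\Phi$ is a Kac-Moody root system (the root system of the Kac-Moody algebra of a generalized Cartan matrix), with simple roots $\alpha_1,\dots,\alpha_r$, simple reflections $s_1,\dots,s_r$, Weyl group $W$ with length function $\ell$, and positive real roots $\Phi^+_{\mathrm{re}}$. $Q=\bigoplus_i\mathbb{Z}\alpha_i$ is the root lattice, $Q^+=\bigoplus_i\mathbb{Z}_{\ge0}\alpha_i$, and $\mathrm{ht}(\sum_i n_i\alpha_i)=\sum_i n_i$. $Q^+_{\mathrm{im}}$ is the set of non-negative integer combinations of positive imaginary roots (equivalently, the elements of $Q^+$ whose whole $W$-orbit lies in $Q^+$). For a commutative ring $R$, $R[[Q^+]]$ is the ring of formal sums $\sum_{\lambda\in Q^+}c_\lambda e^\lambda$, $c_\lambda\in R$. Put $\Delta_{\mathrm{re}}=\prod_{\alpha\in\Phi^+_{\mathrm{re}}}(1-e^\alpha)$,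 $\Delta_{t,\mathrm{re}}=\prod_{\alpha\in\Phi^+_{\mathrm{re}}}(1-te^\alpha)$, and $P(t)=\sum_{w\in W}t^{\ell(w)}\in\mathbb{Z}[[t]]$. Definition of $\mathfrak m$. For $\alpha\in\Phi^+_{\mathrm{re}}$ and $w\in W$ set $w(1-t^ne^\alpha)=1-t^ne^{w(\alpha)}$ if $w(\alpha)>0$, and $w(1-t^ne^\alpha)=(-t^ne^{w(\alpha)})(1-t^{-n}e^{-w(\alpha)})$ if $w(\alpha)<0$; extend multiplicatively to define $w(\Delta_{t,\mathrm{re}}/\Delta_{\mathrm{re}})=\prod_{\alpha\in\Phi^+_{\mathrm{re}}} w(1-te^\alpha)\,w(1-e^\alpha)^{-1}$, an element of $\mathbb{Z}[t,t^{-1}][[Q^+]]$. The sum over $w\in W$ of these converges coefficientwise to a unit of $\mathbb{Z}[[t]][t^{-1}][[Q^+]]$, and $\mathfrak m$ is defined by $$\mathfrak m\sum_{w\in W}w\left(\frac{\Delta_{t,\mathrm{re}}}{\Delta_{\mathrm{re}}}\right)=P(t).$$ The series $\mathfrak m$ has coefficients in $\mathbb{Z}[t]$, constant coefficient $1$, and support in $Q^+_{\mathrm{im}}$, so there are unique integers $m(\lambda,n)$ (for $0\ne\lambda\in Q^+_{\mathrm{im}}$, $n\ge0$), with finitely many nonzero for each $\lambda$, such that $\mathfrak m=\prod_{0\ne\lambda\in Q^+_{\mathrm{im}}}\prod_{n\ge0}(1-t^ne^\lambda)^{-m(\lambda,n)}$. Extend to all nonzero $\lambda\in Q^+$ by: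 $m(\alpha,0)=1$, $m(\alpha,1)=-1$, $m(\alpha,n)=0$ for $n\ge 2$ if $\alpha$ is a positive real root; $m(\lambda,n)=0$ for all $n$ if $\lambda$ is neither in $Q^+_{\mathrm{im}}$ nor a real root. Put $m_\lambda(t)=\sum_{n\ge0}m(\lambda,n)t^n\in\mathbb{Z}[t]$. *)

(* Defs.v *)
From HB Require Import structures.
From mathcomp Require Import all_boot all_order all_algebra.
From mathcomp Require Import boolp classical_sets functions cardinality fsbigop.
Set Implicit Arguments.
Unset Strict Implicit.
Unset Printing Implicit Defensive.
Import Order.TTheory GRing.Theory Num.Theory.
Local Open Scope classical_set_scope.
Local Open Scope ring_scope.

(* R[[Q^+]] for Q^+ = Z_{>=0}^n.  The one-variable case n = 1 also serves as
   the coefficient ring Z[[t]]. *)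
Record fps (R : Type) (n : nat) := Fps { coef : 'cV[nat]_n -> R }.

Section FpsRing.
Variables (R : comNzRingType) (n : nat).
Local Notation T := (fps R n).
Implicit Types (a b c : T) (l m : 'cV[nat]_n).

HB.instance Definition _ := gen_eqMixin T.
HB.instance Definition _ := gen_choiceMixin T.

Lemma fpsP a b : coef a =1 coef b -> a = b.
Proof. by case: a b => [a] [b] /= /funext ->. Qed.

(* the monomial c e^l *)
Definition mon (c : R) l : T := Fps (fun k => if k == l then c else 0).

Definition fps_add a b : T := Fps (fun l => coef a l + coef b l).
Definition fps_opp a : T := Fps (fun l => - coef a l).
Definition fps_mul a b : T :=
  Fps (fun l => \sum_(p \in [set p : 'cV[nat]_n * 'cV[nat]_n | p.1 + p.2 = l])
                   coef a p.1 * coef b p.2).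

Fact fps_addA : associative fps_add.
Proof. by move=> a b c; apply: fpsP => l /=; rewrite addrA. Qed.
Fact fps_addC : commutative fps_add.
Proof. by move=> a b; apply: fpsP => l /=; rewrite addrC. Qed.
Fact fps_add0 : left_id (mon 0 0) fps_add.
Proof. by move=> a; apply: fpsP => l /=; case: ifP; rewrite add0r. Qed.
Fact fps_addN : left_inverse (mon 0 0) fps_opp fps_add.
Proof. by move=> a; apply: fpsP => l /=; rewrite addNr; case: ifP. Qed.

HB.instance Definition _ :=
  Algebra.isZmodule.Build T fps_addA fps_addC fps_add0 fps_addN.

Definition box_emb N (x : 'cV['I_N.+1]_n) : 'cV[nat]_n := map_mx val x.

Lemma box_emb_inj N : injective (@box_emb N).
Proof.
move=> x y /matrixP xy; apply/matrixP => i j.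
by apply: val_inj; have := xy i j; rewrite !mxE.
Qed.

Definition in_box N l := forall i, (l i ord0 <= N)%N.

Lemma box_embK N l : in_box N l -> {x : 'cV['I_N.+1]_n | box_emb x = l}.
Proof.
move=> lN; exists (map_mx (@inord N) l); apply/matrixP => i j.
by rewrite !mxE /= (ord1 j) inordK // ltnS.
Qed.

Lemma in_boxD N l m : in_box N (l + m) -> in_box N l /\ in_box N m.
Proof.
move=> h; split=> i; apply: leq_trans (h i); rewrite !mxE.
  exact: leq_addr.
exact: leq_addl.
Qed.

Lemma fps_mul_box N a b l : in_box N l ->
  coef (fps_mul a b) l =
  \sum_(x : 'cV['I_N.+1]_n) \sum_(y : 'cV['I_N.+1]_n)
     if box_emb x + box_emb y == l
     then coef a (box_emb x) * coef b (box_emb y) else 0.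
Proof.
move=> lN /=; rewrite pair_big /= -big_mkcond /=.
pose g (p : 'cV['I_N.+1]_n * 'cV['I_N.+1]_n) := (box_emb p.1, box_emb p.2).
have g_inj : injective g.
  by move=> [x1 x2] [y1 y2] [] /box_emb_inj -> /box_emb_inj ->.
pose s := [seq g p | p <- index_enum _ & box_emb p.1 + box_emb p.2 == l].
have sP p : p \in s -> p.1 + p.2 = l.
  by move=> /mapP [q]; rewrite mem_filter => /andP [/eqP ql _] ->.
rewrite (fsbigE s).
- rewrite big_seq_cond (eq_bigl (mem s)) -?big_seq ?big_map ?big_filter //.
  by move=> p /=; rewrite andb_idr // => /sP ps; rewrite inE.
- by rewrite map_inj_uniq // filter_uniq // index_enum_uniq.
- by move=> p /= /sP.
- move=> [p q] /= pq; case/in_boxD: (eq_ind_r (in_box N) lN pq) => pN qN.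
  have [x xp] := box_embK pN; have [y yq] := box_embK qN.
  case/negP; apply/mapP; exists (x, y); last by rewrite /g /= xp yq.
  by rewrite mem_filter /= xp yq pq eqxx mem_index_enum.
Qed.

Lemma box_pick N (f : 'cV[nat]_n -> R) l : in_box N l ->
  \sum_(x : 'cV['I_N.+1]_n) (if box_emb x == l then f (box_emb x) else 0) = f l.
Proof.
move=> /box_embK [x0 <-]; rewrite -big_mkcond /=.
by rewrite (big_pred1 x0) // => x; rewrite (inj_eq (@box_emb_inj N)).
Qed.

Lemma in_box_ex l : exists N, in_box N l.
Proof.
exists (\max_i l i ord0)%N => i.
exact: (leq_bigmax_cond (F := fun i => l i ord0)).
Qed.

Fact fps_mulC : commutative fps_mul.
Proof.
move=> a b; apply: fpsP => l; have [N lN] := in_box_ex l.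
rewrite !(fps_mul_box _ _ lN) exchange_big /=.
by apply: eq_bigr => x _; apply: eq_bigr => y _; rewrite addrC mulrC.
Qed.

Fact fps_mulDl : left_distributive fps_mul fps_add.
Proof.
move=> a b c; apply: fpsP => l; have [N lN] := in_box_ex l.
change (coef (fps_mul (fps_add a b) c) l =
        coef (fps_mul a c) l + coef (fps_mul b c) l).
rewrite !(fps_mul_box _ _ lN) -big_split /=.
apply: eq_bigr => x _; rewrite -big_split; apply: eq_bigr => y _ /=.
by case: ifP => _; rewrite ?addr0 // mulrDl.
Qed.

Fact fps_mul1 : left_id (mon 1 0) fps_mul.
Proof.
move=> a; apply: fpsP => l; have [N lN] := in_box_ex l.
have N0 : in_box N (0 : 'cV[nat]_n) by move=> i; rewrite mxE.
rewrite (fps_mul_box _ _ lN) -[RHS](@box_pick N) // exchange_big /=.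
apply: eq_bigr => y _.
have := box_pick (fun x => if x + box_emb y == l
    then coef a (box_emb y) else 0) N0.
rewrite add0r => <-; apply: eq_bigr => x _.
by case: (box_emb x == 0); case: ifP => _; rewrite ?mul1r ?mul0r.
Qed.

Fact fps_mulA : associative fps_mul.
Proof.
have key a b c l N : in_box N l -> coef (fps_mul (fps_mul a b) c) l =
    \sum_(x : 'cV['I_N.+1]_n) \sum_(y : 'cV['I_N.+1]_n)
      \sum_(z : 'cV['I_N.+1]_n)
      if box_emb x + box_emb y + box_emb z == l
      then coef a (box_emb x) * coef b (box_emb y) * coef c (box_emb z) else 0.
  move=> lN; rewrite (fps_mul_box _ _ lN) exchange_big /=.
  transitivity (\sum_(z : 'cV['I_N.+1]_n) \sum_(x : 'cV['I_N.+1]_n)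
      \sum_(y : 'cV['I_N.+1]_n)
      if box_emb x + box_emb y + box_emb z == l
      then coef a (box_emb x) * coef b (box_emb y) * coef c (box_emb z) else 0).
    apply: eq_bigr => z _.
    transitivity (\sum_(p : 'cV['I_N.+1]_n) \sum_(x : 'cV['I_N.+1]_n)
      \sum_(y : 'cV['I_N.+1]_n)
      if box_emb p == box_emb x + box_emb y
      then if box_emb p + box_emb z == l
           then coef a (box_emb x) * coef b (box_emb y) * coef c (box_emb z)
           else 0
      else 0).
      apply: eq_bigr => p _; case: ifP => [/eqP pz|_]; last first.
        by rewrite big1 // => x _; rewrite big1 // => y _; case: ifP.
      have pN : in_box N (box_emb p) by move: lN; rewrite -pz => /in_boxD [].
      rewrite -[X in X * _]/(coef (fps_mul a b) (box_emb p)).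
      rewrite (fps_mul_box _ _ pN) mulr_suml.
      apply: eq_bigr => x _; rewrite mulr_suml.
      apply: eq_bigr => y _; rewrite [in RHS]eq_sym.
      by case: ifP => _; rewrite ?mul0r.
    rewrite exchange_big; apply: eq_bigr => x _; rewrite exchange_big /=.
    apply: eq_bigr => y _; case: ifP => [/eqP xyz|xyz].
      have xyN : in_box N (box_emb x + box_emb y).
        by move: lN; rewrite -xyz => /in_boxD [].
      rewrite (box_pick (fun p => if p + box_emb z == l then
        coef a (box_emb x) * coef b (box_emb y) * coef c (box_emb z) else 0)
        xyN) xyz eqxx //.
    by rewrite big1 // => p _; case: ifP => // /eqP ->; rewrite xyz.
  rewrite exchange_big; apply: eq_bigr => x _; exact: exchange_big.
move=> a b c; apply: fpsP => l; have [N lN] := in_box_ex l.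
rewrite fps_mulC !(key _ _ _ _ _ lN) /=.
rewrite [RHS]exchange_big.
under [RHS]eq_bigr => y _ do rewrite exchange_big.
apply: eq_bigr => y _; apply: eq_bigr => z _; apply: eq_bigr => x _.
rewrite [box_emb y + box_emb z + _]addrC addrA.
by rewrite [_ * coef a _]mulrC mulrA.
Qed.

Fact fps_one_neq0 : mon 1 0 != 0 :> T.
Proof.
apply/eqP => /(congr1 (fun a => coef a 0)) /=.
by rewrite eqxx => /eqP; rewrite oner_eq0.
Qed.

HB.instance Definition _ := GRing.Zmodule_isComNzRing.Build T
  fps_mulA fps_mulC fps_mul1 fps_mulDl fps_one_neq0.

Definition fps_unit : {pred T} := fun a => `[< exists b, b * a = 1 >].
Definition fps_inv a : T :=
  if pselect (exists b, b * a = 1) is left h then projT1 (cid h) else a.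

Fact fps_mulV : {in fps_unit, left_inverse 1 fps_inv *%R}.
Proof.
move=> a /asboolP ua; rewrite /fps_inv; case: pselect => // h.
by case: (cid h).
Qed.
Fact fps_unitP a b : b * a = 1 -> fps_unit a.
Proof. by move=> ba; apply/asboolP; exists b. Qed.
Fact fps_inv_out : {in [predC fps_unit], fps_inv =1 id}.
Proof.
move=> a /= ua; rewrite /fps_inv; case: pselect => // h.
by case/negP: ua; apply/asboolP.
Qed.

HB.instance Definition _ :=
  GRing.ComNzRing_hasMulInverse.Build T fps_mulV fps_unitP fps_inv_out.

(* limit for coefficientwise (eventually constant) convergence; coefficients
   that do not stabilize are set to 0 *)
Definition fps_lim (u : nat -> T) : T :=
  Fps (fun l => xget 0 [set c | exists N,
                          forall k, (N <= k)%N -> coef (u k) l = c]).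

End FpsRing.

Section LieAlgebra.
Variables (F : fieldType) (V : lmodType F) (br : V -> V -> V).

Definition is_lie_bracket : Prop :=
  [/\ forall a x y z, br (a *: x + y) z = a *: br x z + br y z,
      forall a x y z, br z (a *: x + y) = a *: br z x + br z y,
      forall x, br x x = 0 &
      forall x y z, br x (br y z) + br y (br z x) + br z (br x y) = 0].

Definition is_subspace (S : set V) : Prop :=
  S 0 /\ forall a x y, S x -> S y -> S (a *: x + y).

Definition is_subalgebra (S : set V) : Prop :=
  is_subspace S /\ forall x y, S x -> S y -> S (br x y).

Definition is_ideal (S : set V) : Prop :=
  is_subspace S /\ forall x y, S y -> S (br x y).

End LieAlgebra.

Section RootSystem.
Variables (r : nat) (A : 'M[int]_r).

(* a_ij = <alpha_i^vee, alpha_j> *)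
Definition is_gcm : Prop :=
  [/\ forall i, A i i = 2,
      forall i j, i != j -> A i j <= 0 &
      forall i j, A i j = 0 -> A j i = 0].

(* The Kac-Moody algebra g(A) over F, characterized up to isomorphism as in
   Kac, Infinite dimensional Lie algebras, Prop. 1.4.  The Cartan subalgebra is
   the image of F^d under [km_h], where d = 2r - rank A; the j-th row of
   [km_root] is the linear form alpha_j, the i-th column of [km_coroot] is the
   vector alpha_i^vee. *)
Record km_algebra (F : fieldType)
    (d := (2 * r - \rank (map_mx intr A : 'M[F]_r))%N) : Type := KMAlgebra {
  km_sort :> lmodType F;
  km_br : km_sort -> km_sort -> km_sort;
  km_h : {linear 'cV[F]_d -> km_sort};
  km_root : 'M[F]_(r, d);
  km_coroot : 'M[F]_(d, r);
  km_e : 'I_r -> km_sort;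
  km_f : 'I_r -> km_sort;
  km_lie : is_lie_bracket km_br;
  km_h_inj : injective km_h;
  km_root_free : \rank km_root = r;
  km_coroot_free : \rank km_coroot = r;
  km_realization : km_root *m km_coroot = (map_mx intr A)^T;
  km_hh : forall u v, km_br (km_h u) (km_h v) = 0;
  km_ef : forall i j,
    km_br (km_e i) (km_f j) = if i == j then km_h (col i km_coroot) else 0;
  km_he : forall u i, km_br (km_h u) (km_e i) = (km_root *m u) i 0 *: km_e i;
  km_hf : forall u i, km_br (km_h u) (km_f i) = - (km_root *m u) i 0 *: km_f i;
  km_gen : forall S : set km_sort, is_subalgebra km_br S ->
    (forall u, S (km_h u)) -> (forall i, S (km_e i)) -> (forall i, S (km_f i)) ->
    forall x, S x;
  km_radical : forall I : set km_sort, is_ideal km_br I ->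
    (forall u, I (km_h u) -> u = 0) -> forall x, I x -> x = 0
}.

(* Q = 'cV[int]_r and Q^+ = 'cV[nat]_r, in the basis of simple roots *)
Definition toQ (l : 'cV[nat]_r) : 'cV[int]_r := map_mx Posz l.
Definition ht (l : 'cV[nat]_r) : nat := (\sum_i l i 0%R)%N.

Definition is_root (F : fieldType) (a : 'cV[int]_r) : Prop :=
  a != 0 /\
  exists (g : km_algebra F) (x : g), x != 0 /\
    forall u, km_br (km_h g u) x =
              (\sum_i (a i 0)%:~R * (km_root g *m u) i 0) *: x.

(* s_i (v) = v - <v, alpha_i^vee> alpha_i *)
Definition simple_refl (i : 'I_r) : 'M[int]_r := 1%:M - delta_mx i 0 *m row i A.

Definition weyl_word (s : seq 'I_r) : 'M[int]_r :=
  foldr (fun i w => simple_refl i *m w) 1%:M s.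

(* the Weyl group, through its faithful action on Q *)
Definition weyl : set 'M[int]_r := range weyl_word.

Definition weyl_len (w : 'M[int]_r) : nat :=
  xget 0%N [set k | (exists2 s, weyl_word s = w & size s = k) /\
                    forall s, weyl_word s = w -> (k <= size s)%N].

Definition real_root : set 'cV[int]_r :=
  [set a | exists2 w, weyl w & exists i, a = w *m delta_mx i 0].

Definition pos_real : set 'cV[nat]_r := [set a | real_root (toQ a)].

Definition pos_imag (F : fieldType) : set 'cV[nat]_r :=
  [set a | is_root F (toQ a) /\ ~ real_root (toQ a)].

Definition Qim (F : fieldType) : set 'cV[nat]_r :=
  [set l | exists2 s : seq 'cV[nat]_r,
             (forall b, b \in s -> pos_imag F b) & l = \sum_(b <- s) b].

End RootSystem.

Section EulerProduct.
Variables (R : comNzRingType) (r : nat) (t : R).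
Implicit Types (S : set 'cV[nat]_r) (m : 'cV[nat]_r -> {poly int}).

(* prod_{n >= 0} (1 - t^n e^l)^{p_n}, where p_n is the coefficient of t^n in p *)
Definition euler_factor (l : 'cV[nat]_r) (p : {poly int}) : fps R r :=
  \prod_(n < size p) (1 - mon (t ^+ n) l) ^ p`_n.

(* the finite product over the nonzero l in S of height < N *)
Definition euler_trunc S m (N : nat) : fps R r :=
  \big[*%R/1]_(l \in [set l | [/\ S l, l != 0 & (ht l < N)%N]])
    euler_factor l (m l).

Definition euler_prod S m : fps R r := fps_lim (euler_trunc S m).

End EulerProduct.

Definition tvar : fps int 1 := mon 1 (const_mx 1%N).

Section CorrectionFactor.
Variables (r : nat) (A : 'M[int]_r).
Local Notation series := (fps (fps int 1) r).

(* w (1 - t^n e^a), up to the factor - e^(w a) when w a < 0: in that case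
     w (1 - t^n e^a) = (- t^n e^(w a)) (1 - t^-n e^(- w a))
                     = (- e^(w a)) (t^n - e^(- w a)),
   and - e^(w a), which does not depend on n, cancels in the quotients
   w (1 - t e^a) / w (1 - e^a) below. *)
Definition weyl_binom (w : 'M[int]_r) (n : nat) (a : 'cV[nat]_r) : series :=
  let b := w *m toQ a in
  if [forall i, 0 <= b i 0] then 1 - mon (tvar ^+ n) (map_mx absz b)
  else mon (tvar ^+ n) 0 - mon 1 (map_mx absz b).

(* w (Delta_{t,re} / Delta_re) *)
Definition weyl_quot (w : 'M[int]_r) : series :=
  fps_lim (fun N =>
    \big[*%R/1]_(a \in [set a | pos_real A a /\ (ht a < N)%N])
      (weyl_binom w 1 a / weyl_binom w 0 a)).

(* sum over W; for each t^k e^l only finitely many w may contribute *)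
Definition weyl_sum (x : 'M[int]_r -> series) : series :=
  Fps (fun l => Fps (fun k => \sum_(w \in weyl A) coef (coef (x w) l) k)).

Definition poincare : series := weyl_sum (fun w => mon (tvar ^+ weyl_len A w) 0).

(* [frakm] is the series m-fraktur, and the coefficient of t^n in [m l] is the
   integer m(l, n) *)
Definition correction_factor (frakm : series) : Prop :=
  frakm * weyl_sum weyl_quot = poincare.

Definition is_tmult (F : fieldType) (frakm : series)
    (m : 'cV[nat]_r -> {poly int}) : Prop :=
  [/\ frakm = euler_prod tvar (Qim A F) (fun l => - m l),
      forall a, pos_real A a -> m a = 1 - 'X &
      forall l, l != 0 -> ~ pos_real A l -> ~ Qim A F l -> m l = 0].

End CorrectionFactor.

(* The recursion on the height: computes m_l(t) for ht l <= k from the set [Re]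
   of positive real roots and the set [Im] = Q^+_im. *)
Fixpoint tmult_rec (r : nat) (Re Im : set 'cV[nat]_r) (k : nat)
    : 'cV[nat]_r -> {poly int} :=
  if k is k'.+1 then fun l =>
    if l \in Re then 1 - 'X
    else if l \in Im then
      coef (euler_trunc 'X [set: 'cV[nat]_r] (tmult_rec Re Im k') (ht l)) l
    else 0
  else fun=> 0.

(* Main.v *)
Require Import Defs.
From HB Require Import structures.
From mathcomp Require Import all_boot all_order all_algebra.
From mathcomp Require Import boolp classical_sets functions cardinality fsbigop.
From mathcomp Require Import zify ring.
Set Implicit Arguments.
Unset Strict Implicit.
Unset Printing Implicit Defensive.
Import Order.TTheory GRing.Theory Num.Theory.
Local Open Scope classical_set_scope.
Local Open Scope ring_scope.

(* Let D be the product of all factors (1 - t^n e^mu)^(m(mu, n)).  Among the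
   factors of height at least ht(lambda), only those at mu = lambda change the
   coefficient of e^lambda, by - m_lambda(t), so the claim is that D has no such
   coefficient when lambda is a nonzero element of Q^+_im.  As
   D = frakm^-1 Delta_re / Delta_t,re, the definition of frakm gives
     D P(t) = sum_w (Delta_re / Delta_t,re) w (Delta_t,re / Delta_re)
            = sum_w prod_(a in Inv(w)) (t - e^a) / (1 - t e^a),
   where Inv(w) is the set of positive real roots made negative by w^-1.  The
   w-th term is supported in the cone spanned by Inv(w), which w^-1 sends to
   -Q^+, whereas W preserves Q^+_im; so no term meets a nonzero element of
   Q^+_im.  The set Q^+_im is a function of the positive real roots because
   these determine the Cartan matrix: - a_ij is the largest k such that
   alpha_j + k alpha_i is a real root. *)

(** * Positivity of real roots and inversion sets *)

(** Two inputs on W have different sources. Signs of real roots and inversion sets come from the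
    matrix alone, by length arguments in rank two. Stability of Q^+_im concerns imaginary roots,
    which exist only through the Lie algebra. There the set of weights is shown to be stable under
    s_i by computing along sl_2-strings, without exponentials. The strings are finite by the Serre
    relations, which follow from the absence of nonzero ideals missing the Cartan subalgebra.
    Characteristic 0 separates weights and keeps the sl_2 coefficients nonzero. The other obstacle
    is convergence. Infinite products are limits modulo height, but height does not control the sum
    over W. Each factor t - e^a has positive total degree in t and e, so the w-th term has total
    degree at least l(w). A series can therefore be distributed over the sum, one degree at a time.
    Finally, the claim lives in Z[t] and the computation in Z[[t]], and injectivity of the embedding
    carries the result back. *)

Definition nonneg r (v : 'cV[int]_r) : Prop := forall i, 0 <= v i 0.

Section Weyl.
Variables (r : nat) (A : 'M[int]_r).
Hypothesis gcmA : is_gcm A.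
Implicit Types (v : 'cV[int]_r) (w : 'M[int]_r) (i j : 'I_r).

Local Notation "'alpha_ i" := (delta_mx i 0 : 'cV[int]_r) (at level 2).
Local Notation "'s_ i" := (simple_refl A i) (at level 2).
Local Notation len := (weyl_len A).

Definition pairing i v : int := (row i A *m v) 0 0.

Lemma simple_reflE i v : 's_ i *m v = v - pairing i v *: 'alpha_ i.
Proof.
by rewrite mulmxBl mul1mx -mulmxA [row i A *m v]mx11_scalar mul_mx_scalar.
Qed.

Lemma pairing_alpha i j : pairing i 'alpha_ j = A i j.
Proof. by rewrite /pairing -colE !mxE. Qed.

Lemma pairingD i u v : pairing i (u + v) = pairing i u + pairing i v.
Proof. by rewrite /pairing mulmxDr mxE. Qed.

Lemma pairingZ i c v : pairing i (c *: v) = c * pairing i v.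
Proof. by rewrite /pairing -scalemxAr mxE. Qed.

Lemma pairingN i v : pairing i (- v) = - pairing i v.
Proof. by rewrite /pairing mulmxN mxE. Qed.

Lemma mulmx_cV_inj w w' : (forall v, w *m v = w' *m v) -> w = w'.
Proof.
move=> h; apply/matrixP => i j; have := h 'alpha_ j.
by rewrite -!colE => /matrixP/(_ i 0); rewrite !mxE.
Qed.

Lemma simple_refl_sq i : 's_ i *m 's_ i = 1%:M.
Proof.
have [A2 _ _] := gcmA.
apply: mulmx_cV_inj => v; rewrite mul1mx -mulmxA !simple_reflE.
rewrite pairingD pairingN pairingZ pairing_alpha A2.
apply/matrixP => k l; rewrite !mxE; ring.
Qed.

Lemma weyl_word_cat s s' :
  weyl_word A (s ++ s') = weyl_word A s *m weyl_word A s'.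
Proof. by elim: s => [|i s IH] /=; rewrite ?mul1mx // IH mulmxA. Qed.

Lemma weyl_word1 i : weyl_word A [:: i] = 's_ i.
Proof. by rewrite /= mulmx1. Qed.

Lemma weyl_word_rev s : weyl_word A (rev s) *m weyl_word A s = 1%:M.
Proof.
elim: s => [|i s IH] /=; first by rewrite mulmx1.
rewrite rev_cons -cats1 weyl_word_cat weyl_word1 -mulmxA.
by rewrite [X in _ *m X]mulmxA simple_refl_sq mul1mx.
Qed.

Lemma weyl_word_unit s : weyl_word A s \in unitmx.
Proof. by have := mulmx1_unit (weyl_word_rev s) => -[]. Qed.

Lemma weyl_word_inv s : invmx (weyl_word A s) = weyl_word A (rev s).
Proof.
rewrite -[RHS]mulmx1 -(mulmxV (weyl_word_unit s)).
by rewrite mulmxA weyl_word_rev mul1mx.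
Qed.

Lemma weyl_unit w : weyl A w -> w \in unitmx.
Proof. by move=> [s _ <-]; apply: weyl_word_unit. Qed.

Lemma weyl1 : weyl A 1%:M.
Proof. by exists [::]. Qed.

Lemma weylM w w' : weyl A w -> weyl A w' -> weyl A (w *m w').
Proof.
by move=> [s _ <-] [s' _ <-]; exists (s ++ s'); rewrite ?weyl_word_cat.
Qed.

Lemma weylV w : weyl A w -> weyl A (invmx w).
Proof. by move=> [s _ <-]; exists (rev s); rewrite ?weyl_word_inv. Qed.

Lemma weyl_refl i : weyl A 's_ i.
Proof. by exists [:: i]; rewrite ?weyl_word1. Qed.

(** [weyl_len] is an [xget] with default 0; every element of W has a shortest word, so the value is
    a genuine minimum. *)
Lemma weyl_len_spec w : weyl A w ->
  (exists2 s, weyl_word A s = w & size s = len w) /\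
  forall s, weyl_word A s = w -> (len w <= size s)%N.
Proof.
move=> [s0 _ s0w]; rewrite /weyl_len.
pose P k := `[< exists2 s, weyl_word A s = w & size s = k >].
have exP : exists k, P k by exists (size s0); apply/asboolP; exists s0.
case: (ex_minnP exP) => k /asboolP Pk kmin.
apply: (@xgetPex _ 0%N [set k | (exists2 s, weyl_word A s = w & size s = k) /\
                    forall s, weyl_word A s = w -> (k <= size s)%N]).
exists k; split=> // s sw; apply: kmin; apply/asboolP; by exists s.
Qed.

Lemma weyl_len_word s : (len (weyl_word A s) <= size s)%N.
Proof.
have [|_] := @weyl_len_spec (weyl_word A s); first by exists s.
exact.
Qed.

Lemma weyl_lenM w w' : weyl A w -> weyl A w' ->
  (len (w *m w') <= len w + len w')%N.
Proof.
move=> /weyl_len_spec [[s <- <-] _] /weyl_len_spec [[s' <- <-] _].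
by rewrite -weyl_word_cat -size_cat weyl_len_word.
Qed.

Lemma weyl_len1 : len 1%:M = 0%N.
Proof. by apply/eqP; rewrite -leqn0 (weyl_len_word [::]). Qed.

Lemma weyl_len0 w : weyl A w -> len w = 0%N -> w = 1%:M.
Proof. by move=> /weyl_len_spec [[s <- <-] _] /size0nil ->. Qed.

Lemma weyl_lenV w : weyl A w -> len (invmx w) = len w.
Proof.
have le w' : weyl A w' -> (len (invmx w') <= len w')%N.
  move=> /weyl_len_spec [[s <- <-] _].
  by rewrite weyl_word_inv -(size_rev s) weyl_len_word.
move=> ww; apply/eqP; rewrite eqn_leq le //=.
by rewrite -{1}(invmxK w) le //; apply: weylV.
Qed.

Lemma weyl_len_refl i : (len 's_ i <= 1)%N.
Proof. by rewrite -weyl_word1 weyl_len_word. Qed.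

Lemma weyl_len_mulr w i : weyl A w -> (len w <= (len (w *m 's_ i)).+1)%N.
Proof.
move=> ww; have := weyl_lenM (weylM ww (weyl_refl i)) (weyl_refl i).
rewrite -mulmxA simple_refl_sq mulmx1.
by have := weyl_len_refl i; lia.
Qed.

Lemma weyl_len_descent w : weyl A w -> (0 < len w)%N ->
  exists j, len w = (len (w *m 's_ j)).+1.
Proof.
move=> ww; have /weyl_len_spec [[s sw ssz] _] := ww.
case: (lastP s) sw ssz => [_ <- //|s' j] sw ssz _; exists j.
have e : w *m 's_ j = weyl_word A s'.
  by rewrite -sw -cats1 weyl_word_cat weyl_word1 -mulmxA simple_refl_sq mulmx1.
have := weyl_len_mulr j ww; rewrite e => h.
have := weyl_len_word s'; move: h; rewrite -ssz size_rcons; lia.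
Qed.

(* A product of s_i and s_j sends v to v + P alpha_i + R alpha_j; the state
   (P, R, c, d) also records the pairings c, d of this vector with the two
   simple coroots. *)
Definition rank2_step i j (b : bool) (st : int * int * int * int) :=
  let: (P, R, c, d) := st in
  if b then (P - c, R, - c, d - c * A j i) else (P, R - d, c - d * A i j, - d).

Definition rank2_run i j (bs : seq bool) v :=
  foldr (rank2_step i j) (0, 0, pairing i v, pairing j v) bs.

Definition rank2_word i j bs := [seq if b then i else j | b : bool <- bs].

Lemma rank2_runP i j bs v :
  let: (P, R, c, d) := rank2_run i j bs v in
  let u := weyl_word A (rank2_word i j bs) *m v in
  [/\ u = v + P *: 'alpha_ i + R *: 'alpha_ j, pairing i u = c
    & pairing j u = d].
Proof.
have [A2 _ _] := gcmA.
elim: bs => [|b bs IH]; rewrite /rank2_run /=.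
  by rewrite !scale0r !addr0 mul1mx.
rewrite -/(rank2_run i j bs v); case: (rank2_run _ _ _ _) IH => -[[P R] c] d.
move=> [ue ui uj]; case: b => /=; rewrite -mulmxA simple_reflE;
  rewrite ?ui ?uj !pairingD !pairingN !pairingZ !pairing_alpha ?ui ?uj ue A2;
  split; try lia; apply/matrixP => k l; rewrite !mxE; ring.
Qed.

(** The letter [true] stands for s_i and [false] for s_j. A nonempty list ends in [false], so s_j is
    the first reflection applied to alpha_i. *)
Fixpoint alternating (k : nat) : seq bool :=
  if k is k'.+1 then odd k' :: alternating k' else [::].

Lemma size_alternating k : size (alternating k) = k.
Proof. by elim: k => //= k ->. Qed.

(** The increments P and R determine the image of v, so a braid relation reduces to identities
    between expressions in the two pairings of v. *)
Lemma rank2_braid i j m :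
  (forall v, (rank2_run i j (alternating m) v).1.1 =
             (rank2_run i j (map negb (alternating m)) v).1.1) ->
  weyl_word A (rank2_word i j (alternating m)) =
  weyl_word A (rank2_word i j (map negb (alternating m))).
Proof.
move=> h; apply: mulmx_cV_inj => v.
have := rank2_runP i j (alternating m) v.
have := rank2_runP i j (map negb (alternating m)) v.
move: (h v); case: (rank2_run _ _ _ _) => -[[P R] c] d.
case: (rank2_run _ _ _ _) => -[[P' R'] c'] d' /= [-> ->].
by move=> [-> _ _] [-> _ _].
Qed.

Definition rank2_nonneg i j k : Prop :=
  let st := rank2_run i j (alternating k) 'alpha_ i in
  0 <= 1 + st.1.1.1 /\ 0 <= st.1.1.2.

(** The pairing with the coroot reflected last stays nonnegative. As a_ij a_ji >= 4, this forces the
    other pairing to be nonpositive, so every further reflection can only increase a coefficient. *)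
Lemma rank2_infinite i j k : 4 <= A i j * A j i -> i != j -> rank2_nonneg i j k.
Proof.
move=> ge4 ij; have [A2 Aneg _] := gcmA.
have ai := Aneg i j ij; have aj : A j i <= 0 by apply: Aneg; rewrite eq_sym.
suff : let: (P, R, c, d) := rank2_run i j (alternating k) 'alpha_ i in
   [/\ 0 <= 1 + P, 0 <= R, c = 2 * (1 + P) + A i j * R,
       d = 2 * R + A j i * (1 + P) & if odd k then 0 <= d else 0 <= c].
  by rewrite /rank2_nonneg; case: (rank2_run _ _ _ _) => -[[P R] c] d /= [].
elim: k => [|k IH].
  rewrite /rank2_run /= !pairing_alpha A2; split=> //; lia.
rewrite /rank2_run /= -/(rank2_run i j (alternating k) _).
case: (rank2_run _ _ _ _) IH => -[[P R] c] d /= [P0 R0 ce de].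
case: ifP => _ h /=; split=> //; nia.
Qed.

(** The products a_ij a_ji = 0, 1, 2, 3 give m = 2, 3, 4, 6, the order of s_i s_j. Each case is a
    finite computation. *)
Lemma rank2_finite i j : A i j * A j i < 4 -> i != j -> exists2 m, (0 < m)%N &
  (forall k, (k < m)%N -> rank2_nonneg i j k) /\
  weyl_word A (rank2_word i j (alternating m)) =
  weyl_word A (rank2_word i j (map negb (alternating m))).
Proof.
move=> lt4 ij; have [A2 Aneg Azero] := gcmA.
have ai := Aneg i j ij; have aj : A j i <= 0 by apply: Aneg; rewrite eq_sym.
have z1 := Azero i j; have z2 := Azero j i.
have cases : exists2 m, (0 < m)%N & exists a b : nat,
    A i j = - (a%:Z) /\ A j i = - (b%:Z) /\
    ((m, a, b) \in [:: (2, 0, 0); (3, 1, 1); (4, 1, 2); (4, 2, 1);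
                    (6, 1, 3); (6, 3, 1)]%N).
  have [a ae] : exists a : nat, A i j = - (a%:Z).
    by exists `|A i j|%N; lia.
  have [b be] : exists b : nat, A j i = - (b%:Z).
    by exists `|A j i|%N; lia.
  rewrite ae be in lt4 z1 z2 *.
  have ab4 : (a * b < 4)%N by lia.
  have ab0 : (a == 0%N) = (b == 0%N) by lia.
  exists (nth 0 [:: 2; 3; 4; 6] (a * b))%N.
    by case: (a * b)%N ab4 => [|[|[|[|]]]].
  exists a, b; do !split=> //.
  case: a b {ae be lt4 z1 z2} ab4 ab0 => [|[|[|[|a]]]] [|[|[|[|b]]]] //=; lia.
case: cases => m m0 [a [b [ae [be mab]]]]; exists m => //; split.
  move=> k km; rewrite /rank2_nonneg /rank2_run !pairing_alpha A2.
  move: mab km; rewrite !inE => /or4P [||| /or3P []] /eqP [-> ? ?]; subst a b;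
    case: k => [|[|[|[|[|[|k]]]]]] // _ /=; rewrite ?ae ?be; lia.
apply: rank2_braid => v; rewrite /rank2_run.
move: (pairing i v) (pairing j v) => c d.
move: mab; rewrite !inE => /or4P [||| /or3P []] /eqP [-> ? ?]; subst a b;
  rewrite /= ae be; congr (_, _); lia.
Qed.
Lemma alternating_suffix m k : (m <= k)%N ->
  exists2 B, size B = (k - m)%N & alternating k = B ++ alternating m.
Proof.
move=> mk; have [d ->] : exists d, k = (d + m)%N by exists (k - m)%N; lia.
rewrite addnK; elim: d => [|d [B Bd e]]; first by exists [::].
by exists (odd (d + m) :: B); rewrite /= ?Bd ?e.
Qed.

Lemma alternating_rcons m :
  exists2 C, size C = m & alternating m.+1 = rcons C false.
Proof.
have [C Cm e] := @alternating_suffix 1 m.+1 isT; exists C.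
  by rewrite Cm subSS subn0.
by rewrite e cats1.
Qed.

(** Split off from w a right factor in the dihedral group of s_i and s_j, where s_j is a right
    descent of w. The induction hypothesis makes the remaining left factor send both alpha_i and
    alpha_j to nonnegative vectors, and the dihedral factor sends alpha_i to a nonnegative
    combination of these two roots. *)
Lemma weyl_alpha_nonneg w i :
  weyl A w -> (len w <= len (w *m 's_ i))%N -> nonneg (w *m 'alpha_ i).
Proof.
move: {2}(len w) (erefl (len w)) => n; 
elim/ltn_ind: n w i => n IH w i lw ww lwi.
have [n0|n0] := posnP n.
  rewrite (weyl_len0 ww) ?mul1mx; last by rewrite lw.
  by move=> k; rewrite mxE; case: (_ && _).
have [|j wj] := weyl_len_descent ww; first by rewrite lw.
have ij : i != j by apply: contraTneq lwi => ->; rewrite -ltnNge wj.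
(* The split takes the longest alternating factor ending in s_j that can be removed from w on the
   right without loss of length. *)
pose U k := weyl_word A (rank2_word i j (alternating k)).
pose Q k := exists2 v, weyl A v & w = v *m U k /\ len w = (len v + k)%N.
have Q1 : Q 1%N.
  exists (w *m 's_ j); first exact: weylM (weyl_refl _).
  by rewrite addn1 wj /U /= mulmx1 -mulmxA simple_refl_sq mulmx1.
have exQ : exists k, `[< Q k >] by exists 1%N; apply/asboolP.
have Qle k : `[< Q k >] -> (k <= len w)%N.
  by move=> /asboolP [v _ [_ ->]]; rewrite leq_addl.
case: (ex_maxnP exQ Qle) => k /asboolP [v vw [we wl]] kmax.
have k0 : (0 < k)%N by apply: kmax; apply/asboolP.
have vn : (len v < n)%N by rewrite -lw wl; lia.
(* [x k] is the letter that would lengthen [U k] on the left. If it shortened v, the maximal k could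
   be increased. *)
pose x k := if odd k then i else j.
have vx : nonneg (v *m 'alpha_ (x k)).
  apply: (IH _ vn) => //; rewrite leqNgt; apply/negP => lt.
  suff /kmax : `[< Q k.+1 >] by rewrite ltnn.
  apply/asboolP; exists (v *m 's_ (x k)); first exact: weylM (weyl_refl _).
  rewrite {1}we; split.
    rewrite {2}/U [RHS]/= -/(U k) -mulmxA; congr (_ *m _).
    by rewrite mulmxA simple_refl_sq mul1mx.
  by have := weyl_len_mulr (x k) vw; lia.
(* [x k.-1] is the first letter of [U k]. If it shortened v, absorbing it into v would write w with
   fewer than l(w) letters. *)
have vy : nonneg (v *m 'alpha_ (x k.-1)).
  apply: (IH _ vn) => //.
  case: k k0 we wl {kmax vx} => // k _ we wl /=.
  have : (len w <= len (v *m 's_ (x k)) + k)%N.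
    rewrite {1}we {1}/U /= mulmxA -/(U k).
    apply: leq_trans (weyl_lenM (weylM vw (weyl_refl _)) _) _; first by exists
      (rank2_word i j (alternating k)).
    rewrite leq_add2l; apply: leq_trans (weyl_len_word _) _.
    by rewrite size_map size_alternating.
  by lia.
have [vi vj] : nonneg (v *m 'alpha_ i) /\ nonneg (v *m 'alpha_ j).
  case: k k0 vx vy {we wl kmax} => // k _; rewrite /x /=.
  by case: (odd k).
have [P0 R0] : rank2_nonneg i j k.
  have [|lt4] := lerP 4 (A i j * A j i); first by move=> /rank2_infinite; apply.
  have [m m0 [mpos me]] := rank2_finite lt4 ij.
  have [/mpos //|mk] := ltnP k m; exfalso.
  have [B Bk Be] := alternating_suffix mk.
  case: m m0 mk me Bk Be {mpos} => // m _ mk me Bk Be.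
  have [C Cm Ce] := alternating_rcons m.
  (* If k reached the order of s_i s_j, the braid relation would rewrite the end of w so that its
     last letter is s_i. That letter cancels in w s_i, making w s_i shorter than w, against the
     hypothesis. *)
  suff : (len (w *m 's_ i) <= len v + (k - m.+1 + m))%N by lia.
  rewrite we /U Be /rank2_word map_cat weyl_word_cat -/(rank2_word i j _) me.
  rewrite Ce map_rcons /rank2_word map_rcons -cats1 weyl_word_cat.
  rewrite weyl_word1 -!mulmxA simple_refl_sq mulmx1 -weyl_word_cat.
  apply: leq_trans (weyl_lenM vw _) _; first by eexists.
  rewrite leq_add2l; apply: leq_trans (weyl_len_word _) _.
  by rewrite size_cat !size_map Bk Cm.
rewrite we -mulmxA.
have := rank2_runP i j (alternating k) 'alpha_ i; rewrite -/(U k).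
move: P0 R0; case: (rank2_run _ _ _ _) => -[[P R] c] d /= P0 R0 [-> _ _].
rewrite -{1}[delta_mx i 0]scale1r -scalerDl mulmxDr -!scalemxAr => l.
rewrite !mxE addr_ge0 // mulr_ge0 //; [have := vi l|have := vj l];
  by rewrite !mxE.
Qed.

Lemma weyl_alpha_sign w i : weyl A w ->
  nonneg (w *m 'alpha_ i) \/ nonneg (- (w *m 'alpha_ i)).
Proof.
have [A2 _ _] := gcmA.
move=> ww; have [/(weyl_alpha_nonneg ww)|lt] :=
  leqP (len w) (len (w *m 's_ i)); [by left|right].
have := @weyl_alpha_nonneg (w *m 's_ i) i (weylM ww (weyl_refl _)).
rewrite -mulmxA simple_refl_sq mulmx1 => /(_ (ltnW lt)).
rewrite -mulmxA simple_reflE pairing_alpha A2.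
by rewrite scaler_nat mulr2n opprD addrA subrr add0r mulmxN.
Qed.

Lemma real_root_sign b : real_root A b -> nonneg b \/ nonneg (- b).
Proof. by move=> [w ww [i ->]]; apply: weyl_alpha_sign. Qed.

Lemma real_rootM w b : weyl A w -> real_root A b -> real_root A (w *m b).
Proof.
move=> ww [w' ww' [i ->]]; exists (w *m w'); first exact: weylM.
by exists i; rewrite mulmxA.
Qed.

Lemma real_root_alpha i : real_root A 'alpha_ i.
Proof. by exists 1%:M; [exact: weyl1|exists i; rewrite mul1mx]. Qed.

Lemma simple_refl_alpha i : 's_ i *m 'alpha_ i = - 'alpha_ i.
Proof.
have [A2 _ _] := gcmA.
rewrite simple_reflE pairing_alpha A2 scaler_nat mulr2n opprD addrA subrr.
by rewrite add0r.
Qed.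

Lemma real_rootN b : real_root A b -> real_root A (- b).
Proof.
move=> [w ww [i ->]]; exists (w *m 's_ i); first exact: weylM (weyl_refl _).
by exists i; rewrite -mulmxA simple_refl_alpha mulmxN.
Qed.

(** Real roots are primitive vectors: an element of W, invertible over the integers, takes k alpha_i
    to a simple root, so k divides 1. *)
Lemma real_root_multiple i (k : int) : 0 <= k ->
  real_root A (k *: 'alpha_ i) -> k = 1.
Proof.
move=> k0 [w ww [j e]].
have : k * (invmx w *m 'alpha_ i) j 0 = 1.
  have := congr1 (fun v => (invmx w *m v) j 0) e.
  by rewrite mulKmx ?weyl_unit // -scalemxAr !mxE !eqxx.
move: (X in _ * X) => x kx; have := dvdz_mulr x (dvdzz k).
by rewrite kx dvdz1; lia.
Qed.

Lemma real_root_neq0 b : real_root A b -> b != 0.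
Proof.
move=> [w ww [i ->]]; apply/eqP => /(congr1 (mulmx (invmx w))).
rewrite mulKmx ?weyl_unit // mulmx0 => /matrixP /(_ i 0).
by rewrite !mxE !eqxx.
Qed.

Lemma nonneg_toQ (l : 'cV[nat]_r) : nonneg (toQ l).
Proof. by move=> i; rewrite mxE. Qed.

Lemma toQ_inj : injective (@toQ r).
Proof.
move=> x y /matrixP e; apply/matrixP => i j.
by have := e i j; rewrite !mxE => -[].
Qed.

Lemma toQ0 : toQ (0 : 'cV[nat]_r) = 0.
Proof. by apply/matrixP => i j; rewrite !mxE. Qed.

Lemma toQD (l m : 'cV[nat]_r) : toQ (l + m) = toQ l + toQ m.
Proof. by apply/matrixP => i j; rewrite !mxE. Qed.

Lemma toQ_delta i : toQ (delta_mx i 0) = 'alpha_ i.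
Proof. by apply/matrixP => k l; rewrite !mxE; case: (_ && _). Qed.

Lemma toQ_abs v : nonneg v -> toQ (map_mx absz v) = v.
Proof.
by move=> v0; apply/matrixP => i j; rewrite !mxE (ord1 j) gez0_abs.
Qed.

Lemma toQK (l : 'cV[nat]_r) : map_mx absz (toQ l) = l.
Proof. by apply/matrixP => i j; rewrite !mxE. Qed.

Lemma nonneg_anti v : nonneg v -> nonneg (- v) -> v = 0.
Proof.
move=> p n; apply/matrixP => i j; rewrite (ord1 j) !mxE.
by have := n i; rewrite mxE oppr_ge0 => ni; apply/eqP; rewrite eq_le ni p.
Qed.

Lemma real_root_not_both b : real_root A b -> nonneg b -> ~ nonneg (- b).
Proof. by move=> /real_root_neq0/eqP b0 p /(nonneg_anti p). Qed.

Lemma pos_real_neq0 a : pos_real A a -> a != 0.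
Proof. by move=> /real_root_neq0; apply: contraNneq => ->; rewrite toQ0. Qed.

(** s_i changes only the i-th coordinate. A positive real root other than alpha_i has another
    positive coordinate, which decides the sign of its image. *)
Lemma pos_real_refl i a : pos_real A a -> a != delta_mx i 0 ->
  nonneg ('s_ i *m toQ a).
Proof.
move=> ra ai.
have [[j /andP [ji aj]]|no] := pselect (exists j, (j != i) && (0 < a j 0%R)%N).
  have [//|/(_ j)] := real_root_sign (real_rootM (weyl_refl i) ra).
  rewrite simple_reflE !mxE (negPf ji) /= mulr0 subr0; lia.
have e : toQ a = (a i 0)%:Z *: 'alpha_ i.
  apply/matrixP => k l; rewrite (ord1 l) !mxE.
  have [->|ki] := eqVneq k i; first by rewrite /= mulr1.
  rewrite /= mulr0; apply/eqP; rewrite eqz_nat -leqn0 leqNgt; apply/negP => ak.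
  by case: no; exists k; rewrite ki.
have a1 : (a i 0)%:Z = 1 by apply: (@real_root_multiple i); rewrite -?e.
case/eqP: ai; apply: toQ_inj.
by rewrite e a1 scale1r toQ_delta.
Qed.

(** Write w = s_i v with v shorter. Since s_i permutes the positive real roots other than alpha_i,
    the inversions of w are alpha_i and the s_i-images of the inversions of v. *)
Lemma inversions w : weyl A w -> exists s : seq 'cV[nat]_r,
  [/\ uniq s, size s = len w &
    forall a, a \in s <-> pos_real A a /\ ~ nonneg (invmx w *m toQ a)].
Proof.
move: {2}(len w) (erefl (len w)) => n; elim/ltn_ind: n w => n IH w lw ww.
have [n0|n0] := posnP n.
  rewrite n0 in lw; exists [::].
  rewrite (weyl_len0 ww lw) weyl_len1; split=> // a.
  by rewrite invmx1 mul1mx; split=> // -[_ /(_ (nonneg_toQ a))].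
have [|i] := weyl_len_descent (weylV ww); first by rewrite weyl_lenV ?lw.
pose v := 's_ i *m w.
have vw : weyl A v by apply: weylM => //; apply: weyl_refl.
have wv : w = 's_ i *m v by rewrite mulmxA simple_refl_sq mul1mx.
have iv : invmx v = invmx w *m 's_ i.
  apply: (can_inj (mulKmx (weyl_unit vw))).
  rewrite mulmxV ?weyl_unit // /v -mulmxA [w *m _]mulmxA.
  by rewrite mulmxV ?weyl_unit // mul1mx simple_refl_sq.
have iw : invmx w = invmx v *m 's_ i by rewrite iv -mulmxA simple_refl_sq mulmx1.
rewrite -iv !weyl_lenV // => lwv.
have [|s [us szs sP]] := IH _ _ _ (erefl (len v)) vw; first by rewrite -lw; lia.
(* v^-1 s_i = w^-1 is longer than v^-1, so v^-1 alpha_i is positive and w^-1 alpha_i negative: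
   alpha_i is the new inversion. *)
have va : nonneg (invmx v *m 'alpha_ i).
  apply: weyl_alpha_nonneg; first exact: weylV.
  by rewrite -iw !weyl_lenV // lwv.
have nva : ~ nonneg (invmx w *m 'alpha_ i).
  move: va; rewrite iw -mulmxA simple_refl_alpha mulmxN.
  by apply: real_root_not_both; apply: real_rootM (weylV vw) (real_root_alpha i).
pose f (a : 'cV[nat]_r) : 'cV[nat]_r := map_mx absz ('s_ i *m toQ a).
have fK a : pos_real A a -> a != delta_mx i 0 ->
    [/\ pos_real A (f a), f a != delta_mx i 0, f (f a) = a &
       toQ (f a) = 's_ i *m toQ a].
  move=> ra ai; have p := pos_real_refl ra ai.
  have e : toQ (f a) = 's_ i *m toQ a by rewrite /f toQ_abs.
  have rf : pos_real A (f a).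
    by rewrite /pos_real /= e; apply: real_rootM => //; apply: weyl_refl.
  split=> //.
    apply/eqP => fi; move: e; rewrite fi toQ_delta.
    move=> /(congr1 (mulmx 's_ i)); rewrite mulmxA simple_refl_sq mul1mx.
    rewrite simple_refl_alpha => /matrixP /(_ i 0).
    by rewrite !mxE !eqxx.
  by rewrite {1}/f e mulmxA simple_refl_sq mul1mx toQK.
have s_i a : a \in s -> a != delta_mx i 0.
  by move=> /sP [_]; apply: contra_notN => /eqP ->; rewrite toQ_delta.
exists (delta_mx i 0 :: map f s); split.
- rewrite /= map_inj_in_uniq ?us ?andbT.
    apply/mapP => -[a ain e]; have [ra _] := (sP a).1 ain.
    by have [_ + _ _] := fK a ra (s_i a ain); rewrite -e eqxx.
  move=> a b ain bin e; have [ra _] := (sP a).1 ain.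
  have [rb _] := (sP b).1 bin.
  have [_ _ <- _] := fK a ra (s_i a ain).
  by have [_ _ <- _] := fK b rb (s_i b bin); rewrite e.
- by rewrite /= size_map szs lwv.
move=> a; rewrite inE; have [->|ai] := eqVneq a (delta_mx i 0).
  by rewrite /= toQ_delta /pos_real /= toQ_delta; split=> // _; split=> //;
     apply: real_root_alpha.
rewrite /=; split.
  move=> /mapP [b bin ->]; have [rb nb] := (sP b).1 bin.
  have [rf _ _ e] := fK b rb (s_i b bin).
  split=> //; rewrite iw e -mulmxA [X in _ *m X]mulmxA simple_refl_sq mul1mx //.
move=> [ra na]; apply/mapP.
have [rf _ ff e] := fK a ra ai; exists (f a) => //.
by apply/sP; split=> //; rewrite e mulmxA -iw.
Qed.

Lemma weyl_finite_len n : exists s : seq 'M[int]_r,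
  forall w, weyl A w -> (len w < n)%N -> w \in s.
Proof.
exists [seq weyl_word A (tval (tagged x)) |
          x <- enum {: {k : 'I_n & k.-tuple 'I_r}}].
move=> w.
move=> /weyl_len_spec [[s sw ssz] _] lw.
rewrite -ssz in lw; apply/mapP.
exists (Tagged (fun k : 'I_n => k.-tuple 'I_r)
                (in_tuple s : (Ordinal lw).-tuple _)).
  by rewrite mem_enum.
by rewrite /= sw.
Qed.
End Weyl.

(** The vector alpha_j - a_ij alpha_i is a real root for A, hence for B. The i-th reflection of B
    sends it to alpha_j + (a_ij - b_ij) alpha_i, whose alpha_j-coefficient is 1, so its other
    coefficient cannot be negative. *)
Lemma pos_real_gcm_le r (A B : 'M[int]_r) : is_gcm A -> is_gcm B ->
  pos_real A = pos_real B -> forall i j, i != j -> B i j <= A i j.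
Proof.
move=> gA gB e i j ij; have [_ Aneg _] := gA.
have := Aneg i j ij => a0.
pose b : 'cV[int]_r := simple_refl A i *m delta_mx j 0.
have be : b = delta_mx j 0 - A i j *: delta_mx i 0.
  by rewrite /b simple_reflE pairing_alpha.
have bp : nonneg b.
  move=> k; rewrite be !mxE /=; case: (k == i); case: (k == j) => /=; lia.
have : pos_real A (map_mx absz b).
  rewrite /pos_real /= toQ_abs //.
  by apply: real_rootM; [exact: weyl_refl|exact: real_root_alpha].
rewrite e /pos_real /= toQ_abs // => /(real_rootM (weyl_refl B i)).
move=> /(real_root_sign gB); have [B2 _ _] := gB.
rewrite simple_reflE be pairingD pairingN pairingZ !pairing_alpha B2.
have ji : j == i = false by rewrite eq_sym (negPf ij).
by case=> [/(_ i)|/(_ j)]; rewrite !mxE !eqxx ?ji ?(negPf ij) /=; lia.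
Qed.

Lemma pos_real_gcm_inj r (A B : 'M[int]_r) : is_gcm A -> is_gcm B ->
  pos_real A = pos_real B -> A = B.
Proof.
move=> gA gB e; apply/matrixP => i j; have [->|ij] := eqVneq i j.
  by have [-> _ _] := gA; have [-> _ _] := gB.
by apply/eqP; rewrite eq_le !pos_real_gcm_le.
Qed.

(** * Weights of the Kac-Moody algebra *)

Section LieBracket.
Variables (F : fieldType) (V : lmodType F) (br : V -> V -> V).
Hypothesis lie : is_lie_bracket br.

Lemma lieDl x y z : br (x + y) z = br x z + br y z.
Proof. by case: lie => /(_ 1 x y z); rewrite !scale1r. Qed.

Lemma lieDr x y z : br z (x + y) = br z x + br z y.
Proof. by case: lie => _ /(_ 1 x y z); rewrite !scale1r. Qed.

Lemma lie0l z : br 0 z = 0.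
Proof. by apply: (addIr (br 0 z)); rewrite -lieDl !add0r. Qed.

Lemma lie0r z : br z 0 = 0.
Proof. by apply: (addIr (br z 0)); rewrite -lieDr !add0r. Qed.

Lemma lieZl a x z : br (a *: x) z = a *: br x z.
Proof. by case: lie => /(_ a x 0 z); rewrite lie0l !addr0. Qed.

Lemma lieZr a x z : br z (a *: x) = a *: br z x.
Proof. by case: lie => _ /(_ a x 0 z); rewrite lie0r !addr0. Qed.

Lemma lieNr x z : br z (- x) = - br z x.
Proof. by rewrite -scaleN1r lieZr scaleN1r. Qed.

Lemma liexx x : br x x = 0.
Proof. by case: lie. Qed.

Lemma lieC x y : br x y = - br y x.
Proof.
apply/eqP; rewrite -addr_eq0; have := liexx (x + y).
by rewrite lieDl !lieDr !liexx add0r addr0 => ->.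
Qed.

Lemma lie_jacobi x y z : br x (br y z) = br (br x y) z + br y (br x z).
Proof.
have [_ _ _ /(_ x y z) /eqP] := lie.
rewrite -addrA addr_eq0 => /eqP ->.
by rewrite opprD -lieNr -lieC [br z _]lieC opprK addrC.
Qed.

(** Reduces stability of a subspace under every ad x to a check on generators. *)
Lemma is_subalgebra_stable (S : set V) : is_subspace S ->
  is_subalgebra br [set x | forall y, S y -> S (br x y)].
Proof.
move=> [S0 SD]; have SZD a x y : S x -> S y -> S (a *: x + y) by apply: SD.
split; [split=> [y Sy|a x x' Sx Sx' y Sy]|move=> x x' Sx Sx' y Sy] => /=.
- by rewrite lie0l.
- by rewrite lieDl lieZl; apply: SD; [apply: Sx|apply: Sx'].
- have -> : br (br x x') y = (- 1) *: br x' (br x y) + br x (br x' y).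
    by rewrite (lie_jacobi x) scaleN1r addrCA addNr addr0.
  by apply: SD; [apply/Sx'/Sx|apply/Sx/Sx'].
Qed.

Lemma iter_lie0 n x : iter n (br x) 0 = 0.
Proof. by elim: n => //= n ->; rewrite lie0r. Qed.

Lemma iter_lieZD n x a y z :
  iter n (br x) (a *: y + z) = a *: iter n (br x) y + iter n (br x) z.
Proof. by elim: n => //= n ->; rewrite lieDr lieZr. Qed.

Lemma iter_lie_geq n m x y : (n <= m)%N ->
  iter n (br x) y = 0 -> iter m (br x) y = 0.
Proof. by move=> nm h; rewrite -(subnK nm) iterD h iter_lie0. Qed.

(** ad x is a derivation: by the Leibniz rule, exponents killing y and z add up to one killing their
    bracket. Local nilpotency can thus be checked on generators. *)
Lemma ad_nilpotent_subalgebra x :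
  is_subalgebra br [set y | exists n, iter n (br x) y = 0].
Proof.
split; [split|].
- by exists 0%N.
- move=> a y z [n yn] [m zm]; exists (n + m)%N.
  rewrite iter_lieZD (iter_lie_geq (leq_addr _ _) yn).
  by rewrite (iter_lie_geq (leq_addl _ _) zm) scaler0 addr0.
move=> y z [n yn] [m zm]; exists (n + m)%N.
move: {2}(n + m)%N (erefl (n + m)%N) => k.
elim: k n m y z yn zm => [|k IH] n m y z yn zm e; rewrite e.
  by case: n e yn => //= _ ->; rewrite lie0l.
case: n yn e => [/= ->|n yn e].
  by rewrite lie0l -/(iter k.+1 _ _) iter_lie0.
case: m zm e => [/= ->|m zm e].
  by rewrite lie0r -/(iter k.+1 _ _) iter_lie0.
rewrite iterSr lie_jacobi -[br (br x y) z]scale1r iter_lieZD scale1r.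
have e1 : (n + m.+1 = k)%N by lia.
have e2 : (n.+1 + m = k)%N by lia.
rewrite -{1}e1 IH -?iterSr // -{1}e2 IH -?iterSr // addr0 //.
Qed.
End LieBracket.

(** * Triangular decomposition, Serre relations and sl_2-strings *)

Section KacMoody.
Variables (F : fieldType) (r : nat) (A : 'M[int]_r) (g : km_algebra A F).
Hypothesis charF0 : [pchar F] =i pred0.
Hypothesis gcmA : is_gcm A.
Local Notation br := (@km_br r A F g).
Local Notation h := (km_h g).
Local Notation d := (2 * r - \rank (map_mx intr A : 'M[F]_r))%N.
Local Notation "'alpha_ i" := (delta_mx i 0 : 'cV[int]_r) (at level 2).
Implicit Types (a : 'cV[int]_r) (x y z : g) (u : 'cV[F]_d) (b : bool).

Let lie : is_lie_bracket br := km_lie g.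

Definition wform a u : F := \sum_i (a i 0)%:~R * (km_root g *m u) i 0.
Definition weight_vector a x : Prop := forall u, br (h u) x = wform a u *: x.

Lemma wformD a a' u : wform (a + a') u = wform a u + wform a' u.
Proof.
by rewrite /wform -big_split; apply: eq_bigr => i _; rewrite !mxE intrD mulrDl.
Qed.

Lemma wformZ k a u : wform (k *: a) u = k%:~R * wform a u.
Proof.
rewrite /wform mulr_sumr; apply: eq_bigr => i _.
by rewrite mxE intrM mulrA.
Qed.

Lemma wform_alpha i u : wform 'alpha_ i u = (km_root g *m u) i 0.
Proof.
rewrite /wform (bigD1 i) //= big1 => [|j ji]; last first.
  by rewrite mxE (negPf ji) mul0r.
by rewrite mxE !eqxx mul1r addr0.
Qed.

Lemma wform_coroot a i : wform a (col i (km_coroot g)) = (pairing A i a)%:~R.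
Proof.
rewrite /wform colE mulmxA km_realization -colE /pairing mxE rmorph_sum.
by apply: eq_bigr => j _; rewrite !mxE /= intrM mulrC.
Qed.

Lemma intr_inj_char0 : injective (intr : int -> F).
Proof.
move=> m n /eqP; rewrite -subr_eq0 -intrB => /eqP e.
apply/eqP; rewrite -subr_eq0 -absz_eq0 -((pcharf0P F).1 charF0).
have : `|m - n|%N%:Z = m - n \/ `|m - n|%N%:Z = - (m - n) by lia.
by rewrite pmulrn => -[] ->; rewrite ?intrN e ?oppr0.
Qed.

(** The simple roots are linearly independent forms, so some u reads off a coordinate where a and a'
    differ; characteristic 0 keeps the two values distinct. *)
Lemma wform_sep a a' : a != a' -> exists u, wform a u != wform a' u.
Proof.
move=> aa'; have [k ak] : exists k, a k 0 != a' k 0.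
  apply/existsP; rewrite -negb_forall; apply: contra_neqN aa' => /forallP e.
  by apply/matrixP => i j; rewrite (ord1 j); apply/eqP.
exists (pinvmx (km_root g) *m delta_mx k 0).
have e c : wform c (pinvmx (km_root g) *m delta_mx k 0) = (c k 0)%:~R.
  rewrite /wform mulmxA mulmxVp; last by rewrite /row_free km_root_free.
  rewrite mul1mx (bigD1 k) //= big1 => [|j jk]; last first.
    by rewrite mxE (negPf jk) mulr0.
  by rewrite mxE !eqxx mulr1 addr0.
by rewrite !e (inj_eq intr_inj_char0).
Qed.

Lemma weight_vector_lie a a' x y :
  weight_vector a x -> weight_vector a' y -> weight_vector (a + a') (br x y).
Proof.
move=> wx wy u; rewrite (lie_jacobi lie) wx wy (lieZl lie) (lieZr lie).
by rewrite -scalerDl wformD.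
Qed.

(** The boolean selects e_i or f_i, so that each argument below serves both halves of the triangular
    decomposition. *)
Definition gen b i : g := if b then km_e g i else km_f g i.
Definition sg b : int := if b then 1 else -1.

Lemma sgN b : sg (~~ b) = - sg b.
Proof. by case: b. Qed.

Lemma sgK b : sg b * sg b = 1.
Proof. by case: b. Qed.

Lemma weight_vector_gen b i : weight_vector (sg b *: 'alpha_ i) (gen b i).
Proof.
move=> u; rewrite wformZ wform_alpha; case: b; rewrite /= ?km_he ?km_hf.
  by rewrite mul1r.
by rewrite mulN1r.
Qed.

Lemma weight_vector_h u : weight_vector 0 (h u).
Proof.
by move=> v; rewrite km_hh /wform big1 ?scale0r // => i _; rewrite mxE mul0r.
Qed.

Lemma lie_genN b i j : br (gen b i) (gen (~~ b) j) =
  if i == j then (sg b)%:~R *: h (col i (km_coroot g)) else 0.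
Proof.
case: b => /=; first by rewrite km_ef scale1r.
rewrite (lieC lie) km_ef eq_sym; case: eqP => [->|]; last by rewrite oppr0.
by rewrite scaleN1r.
Qed.

Lemma km_generated (S : set g) : is_subalgebra br S -> (forall u, S (h u)) ->
  (forall b i, S (gen b i)) -> forall x, S x.
Proof.
move=> Salg Sh Sg; apply: (km_gen Salg) => // i.
  exact: (Sg true).
exact: (Sg false).
Qed.

Inductive wspan (P : 'cV[int]_r -> g -> Prop) : g -> Prop :=
| wspan0 : wspan P 0
| wspan_cons a c x y : P a x -> wspan P y -> wspan P (c *: x + y).

Section WSpan.
Variable P : 'cV[int]_r -> g -> Prop.

Lemma wspan_incl a x : P a x -> wspan P x.
Proof.
by move=> Px; rewrite -[x]scale1r -[_ *: x]addr0; apply: wspan_cons Px (wspan0 _).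
Qed.

Lemma wspan_subspace : is_subspace (wspan P).
Proof.
split; first exact: wspan0.
move=> c x y; elim=> [|a c' x' y' Px' _ IH] Sy; first by rewrite scaler0 add0r.
rewrite scalerDr scalerA -addrA; apply: wspan_cons Px' _; exact: IH.
Qed.

Lemma wspanD x y : wspan P x -> wspan P y -> wspan P (x + y).
Proof.
by move=> Sx Sy; rewrite -[x]scale1r; apply: (wspan_subspace.2).
Qed.

Lemma wspanZ c x : wspan P x -> wspan P (c *: x).
Proof.
move=> Sx; rewrite -[_ *: x]addr0; apply: (wspan_subspace.2) => //.
exact: wspan0.
Qed.

Lemma wspan_lie (Q : 'cV[int]_r -> g -> Prop) z :
  (forall a x, P a x -> wspan Q (br z x)) ->
  forall x, wspan P x -> wspan Q (br z x).
Proof.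
move=> zP x; elim=> [|a c y y' Py _ IH].
  by rewrite (lie0r lie); apply: wspan0.
rewrite (lieDr lie) (lieZr lie).
move: (zP _ _ Py) IH.
move: (br z y) (br z y') => w w'; elim=> [|a' c' v v' Qv _ IHv] Sw'.
  by rewrite scaler0 add0r.
by rewrite scalerDr scalerA -addrA; apply: wspan_cons Qv (IHv Sw').
Qed.

Hypothesis Pweight : forall a x, P a x -> weight_vector a x.

(** Otherwise x is a combination of vectors of weights a' different from a. For each a' choose u
    separating it from a and apply ad(h u) - a'(u): the composite kills the combination, yet
    multiplies x by a nonzero scalar. *)
Lemma wspan_weight a x : weight_vector a x -> wspan P x -> x != 0 ->
  exists2 y, P a y & y != 0.
Proof.
move=> wx Sx; apply: contraPP => /forall2NP no; apply/negP; rewrite negbK.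
have Pa y : P a y -> y = 0.
  by move=> Py; have [//|/negP] := no y; rewrite negbK => /eqP.
pose op (p : 'cV[F]_d * 'cV[int]_r) z := br (h p.1) z - wform p.2 p.1 *: z.
pose T l z := foldr op z l.
have TZD l c y z : T l (c *: y + z) = c *: T l y + T l z.
  elim: l => //= p l; rewrite -!/(T l _) => ->.
  rewrite /op (lieDr lie) (lieZr lie) scalerDr [in RHS]scalerBr opprD.
  by rewrite !scalerA [in LHS]mulrC addrACA.
have Tw l a' z : weight_vector a' z ->
    T l z = \prod_(p <- l) (wform a' p.1 - wform p.2 p.1) *: z.
  move=> wz; elim: l => [|p l IH]; first by rewrite big_nil scale1r.
  rewrite /= IH big_cons /op (lieZr lie) wz !scalerA -scalerBl.
  by rewrite mulrC -mulrBl.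
have [l lsep lx] : exists2 l,
    (forall p, p \in l -> wform a p.1 != wform p.2 p.1) & T l x = 0.
  elim: Sx => [|a' c y z Py _ [l lsep lz]].
    by exists [::].
  have [ea|/wform_sep [u sep]] := eqVneq a a'.
    by exists l => //; rewrite (Pa y) ?ea // scaler0 add0r.
  exists ((u, a') :: l).
    by move=> p; rewrite inE => /orP [/eqP ->|/lsep].
  rewrite /= -/(T l _) TZD lz addr0 (Tw l a' y (Pweight Py)) /op /=.
  by rewrite scalerA (lieZr lie) (Pweight Py) !scalerA [_ * _]mulrC subrr.
apply/eqP; move/eqP: lx; rewrite (Tw l a) // scaler_eq0 => /orP [|/eqP //].
rewrite prodf_seq_eq0 => /hasP [p /lsep + /andP [_]].
by rewrite subr_eq0 => /negPf ->.
Qed.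
End WSpan.

Inductive gen_word b : 'cV[int]_r -> g -> Prop :=
| gen_word1 i : gen_word b (sg b *: 'alpha_ i) (gen b i)
| gen_wordS i a x : gen_word b a x ->
    gen_word b (sg b *: 'alpha_ i + a) (br (gen b i) x).

Lemma gen_word_weight b a x : gen_word b a x -> weight_vector a x.
Proof.
elim=> [i|i a' y _ IH]; first exact: weight_vector_gen.
exact: weight_vector_lie (weight_vector_gen _ _) IH.
Qed.

Lemma gen_word_nonneg b a x : gen_word b a x -> nonneg (sg b *: a).
Proof.
elim=> [i|i a' y _ IH] j; rewrite ?scalerDr ?scalerA ?sgK ?scale1r.
  by rewrite mxE; case: (_ && _).
by rewrite mxE addr_ge0 //; rewrite mxE; case: (_ && _).
Qed.

(** All letters of a word of weight k alpha_i equal i, and the innermost bracket of a word with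
    several letters is then that of a generator with itself. *)
Lemma gen_word_alpha b a x i k : gen_word b a x -> a = k *: 'alpha_ i ->
  x != 0 -> a = sg b *: 'alpha_ i.
Proof.
move=> bx; suff H : (exists k, a = k *: 'alpha_ i) ->
    x = 0 \/ x = gen b i /\ a = sg b *: 'alpha_ i.
  move=> ak x0; have [|e|[_ //]] := H; first by exists k.
  by rewrite e eqxx in x0.
elim: bx => {a x k} [j|j a x bx IH] [k e].
  right; suff -> : j = i by [].
  apply/eqP; move/matrixP/(_ j 0): e; rewrite !mxE !eqxx /=.
  by case: (j == i) => //=; rewrite mulr0; case: (b).
have ji : j = i.
  apply/eqP; apply/negP => /negP ji; have := gen_word_nonneg bx j.
  move/matrixP/(_ j 0): e; rewrite !mxE !eqxx (negPf ji) /=.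
  by case: (b) => /=; lia.
subst j; left; have [|->|[-> _]] := IH.
- exists (k - sg b); rewrite scalerBl -e [_ + a]addrC addrK //.
- by rewrite (lie0r lie).
by rewrite (liexx lie).
Qed.

Definition triangular a x : Prop :=
  (a = 0 /\ exists u, x = h u) \/ exists b, gen_word b a x.

Lemma triangular_weight a x : triangular a x -> weight_vector a x.
Proof.
case=> [[-> [u ->]]|[b /gen_word_weight //]]; exact: weight_vector_h.
Qed.

Lemma lie_gen_h b i u :
  br (gen b i) (h u) = - wform (sg b *: 'alpha_ i) u *: gen b i.
Proof. by rewrite (lieC lie) weight_vector_gen scaleNr. Qed.

(** The span of the Cartan subalgebra and of the words of both signs contains the generators and is
    stable under them, hence under the whole algebra. *)
Lemma triangular_span x : wspan triangular x.
Proof.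
pose half b a x := (a = 0 /\ exists u, x = h u) \/ gen_word b a x.
have half_gen b i y : wspan (half b) y -> wspan (half b) (br (gen b i) y).
  apply: wspan_lie => a z [[_ [u ->]]|bz].
    rewrite lie_gen_h; apply: wspanZ; apply: wspan_incl.
    by right; apply: gen_word1.
  by apply: wspan_incl; right; apply: gen_wordS bz.
(* An opposite generator moved inwards through a word meets each letter in a vector of the Cartan
   subalgebra or in 0, so no word of mixed signs is created. *)
have half_genN b i a y : gen_word (~~ b) a y ->
    wspan (half (~~ b)) (br (gen b i) y).
  elim=> [j|j a' z bz IH].
    rewrite lie_genN; case: eqP => _; last exact: wspan0.
    by apply: wspanZ; apply: (@wspan_incl _ 0); left; split=> //; eexists.
  rewrite (lie_jacobi lie); apply: wspanD; last exact: half_gen.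
  rewrite lie_genN; case: eqP => _; last by rewrite (lie0l lie); apply: wspan0.
  rewrite (lieZl lie) (gen_word_weight bz) scalerA; apply: wspanZ.
  by apply: wspan_incl; right; apply: bz.
have half_sub b y : wspan (half b) y -> wspan triangular y.
  elim=> [|a c z z' hz _ IH]; first exact: wspan0.
  apply: (@wspan_cons _ a) => //; case: hz; first by left.
  by right; exists b.
have gen_stable b i y : wspan triangular y -> wspan triangular (br (gen b i) y).
  apply: wspan_lie => a z [[_ [u ->]]|[b' bz]].
    rewrite lie_gen_h; apply: wspanZ; apply: wspan_incl.
    by right; exists b; apply: gen_word1.
  have [eb|nb] := eqVneq b' b.
    apply: wspan_incl; right; exists b; apply: gen_wordS.
    by rewrite -eb; apply: bz.
  have eb : b' = ~~ b by case: (b) (b') nb => -[].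
  by rewrite eb in bz; apply: half_sub (half_genN _ _ _ _ bz).
have stable y : forall z, wspan triangular z -> wspan triangular (br y z).
  move: y; apply: km_generated gen_stable.
    exact: (is_subalgebra_stable lie (wspan_subspace _)).
  move=> u y; apply: wspan_lie => a z tz.
  rewrite (triangular_weight tz); apply: wspanZ; exact: wspan_incl tz.
move: x; apply: km_generated.
- by split=> [|y z _]; [exact: wspan_subspace|exact: stable].
- by move=> u; apply: (@wspan_incl _ 0); left; split=> //; exists u.
move=> b i; apply: (@wspan_incl _ (sg b *: 'alpha_ i)).
by right; exists b; apply: gen_word1.
Qed.

Lemma weight_vector_word a x : weight_vector a x -> x != 0 -> a != 0 ->
  exists b y, gen_word b a y /\ y != 0.
Proof.
move=> wx x0 a0.
have [y [[e _]|[b by_]] y0] :=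
  wspan_weight triangular_weight wx (triangular_span x) x0.
  by rewrite e eqxx in a0.
by exists b, y.
Qed.

Lemma weight_vector_sign a x : weight_vector a x -> x != 0 ->
  nonneg a \/ nonneg (- a).
Proof.
move=> wx x0; have [->|a0] := eqVneq a 0.
  by left=> i; rewrite mxE.
have [b [y [/gen_word_nonneg +]] _] := weight_vector_word wx x0 a0.
by case: b => /=; rewrite ?scale1r ?scaleN1r; [left|right].
Qed.

Lemma weight_vector_alpha i k x : weight_vector (k *: 'alpha_ i) x ->
  x != 0 -> k *: 'alpha_ i != 0 -> exists b, k *: 'alpha_ i = sg b *: 'alpha_ i.
Proof.
move=> wx x0 a0; have [b [y [bw y0]]] := weight_vector_word wx x0 a0.
by exists b; apply: gen_word_alpha bw _ y0.
Qed.

(* The ideal generated by an extremal vector only involves weights on the same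
   side, so it misses the Cartan subalgebra. *)
Lemma extremal_vector_eq0 b a z : weight_vector a z -> nonneg (sg b *: a) ->
  a != 0 -> (forall k, br (gen (~~ b) k) z = 0) -> z = 0.
Proof.
move=> wz na a0 kz.
pose P a' x := exists s : seq 'I_r, a' = \sum_(i <- s) sg b *: 'alpha_ i + a /\
  x = foldr (fun i => br (gen b i)) z s.
have Pw a' x : P a' x -> weight_vector a' x.
  move=> [s [-> ->]]; elim: s => [|i s IH]; first by rewrite big_nil add0r.
  rewrite big_cons -addrA; exact: weight_vector_lie (weight_vector_gen _ _) IH.
have gen_stable b' k y : wspan P y -> wspan P (br (gen b' k) y).
  have [->|nb] := eqVneq b' b.
    apply: wspan_lie => a' x [s [_ ->]].
    apply: (@wspan_incl _ (\sum_(i <- k :: s) sg b *: 'alpha_ i + a)).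
    by exists (k :: s).
  have -> : b' = ~~ b by case: (b) (b') nb => -[].
  apply: wspan_lie => a' x [s [_ ->]].
  elim: s => [|i s IH] /=; first by rewrite kz; apply: wspan0.
  have Ps : P (\sum_(i <- s) sg b *: 'alpha_ i + a)
      (foldr (fun i => br (gen b i)) z s) by exists s.
  rewrite (lie_jacobi lie); apply: wspanD; last first.
    move: IH; apply: wspan_lie => a'' x' [s' [_ ->]].
    apply: (@wspan_incl _ (\sum_(i <- i :: s') sg b *: 'alpha_ i + a)).
    by exists (i :: s').
  rewrite -{2}[b]negbK lie_genN; case: eqP => _; last first.
    by rewrite (lie0l lie); apply: wspan0.
  rewrite (lieZl lie) (Pw _ _ Ps) scalerA; apply: wspanZ; exact: wspan_incl Ps.
have stable y : forall x, wspan P x -> wspan P (br y x).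
  move: y; apply: km_generated gen_stable.
    exact: (is_subalgebra_stable lie (wspan_subspace _)).
  move=> u y; apply: wspan_lie => a' x Px.
  rewrite (Pw _ _ Px); apply: wspanZ; exact: wspan_incl Px.
apply: (@km_radical r A F g (wspan P)).
- by split=> [|x y]; [exact: wspan_subspace|exact: stable].
- move=> u Pu; apply: (@km_h_inj r A F g); rewrite raddf0; apply/eqP.
  apply: contrapT => /negP u0.
  have [y [s [e _]] _] := wspan_weight Pw (weight_vector_h u) Pu u0.
  have ns : nonneg (sg b *: (\sum_(i <- s) sg b *: 'alpha_ i)).
    elim: s {e} => [|k s IH] j; first by rewrite big_nil scaler0 mxE.
    rewrite big_cons scalerDr scalerA sgK scale1r mxE addr_ge0 //.
    by rewrite mxE; case: (_ && _).
  move/esym/eqP: e; rewrite addr_eq0 => /eqP e.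
  rewrite e scalerN in ns; have := nonneg_anti na ns.
  move: a0; case: (b) => /=; rewrite ?scale1r ?scaleN1r => /negP a0 /eqP //.
  by rewrite oppr_eq0.
by apply: (@wspan_incl _ a); exists [::]; rewrite big_nil add0r.
Qed.

Lemma weight_vector_iter b i n a y : weight_vector a y ->
  weight_vector (a + n%:Z *: (sg b *: 'alpha_ i)) (iter n (br (gen b i)) y).
Proof.
move=> wy; elim: n => [|n IH] /=; first by rewrite scale0r addr0.
rewrite -[in X in weight_vector X](addn1 n) PoszD scalerDl scale1r addrA addrC.
exact: weight_vector_lie (weight_vector_gen _ _) IH.
Qed.

(** Moving the opposite generator past the letters contributes c + 2k for k = 0, ..., n, where c is
    [sg b * pairing A i a]; these terms add up to (n + 1)(c + n). *)
Lemma sl2_iter b i n a y : weight_vector a y -> br (gen (~~ b) i) y = 0 ->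
  br (gen (~~ b) i) (iter n.+1 (br (gen b i)) y) =
  - (n.+1%:Z * (sg b * pairing A i a + n%:Z))%:~R *: iter n (br (gen b i)) y.
Proof.
have [A2 _ _] := gcmA.
move=> wy y0; have step k : br (gen (~~ b) i) (iter k.+1 (br (gen b i)) y) =
    - (sg b * pairing A i a + 2 * k%:Z)%:~R *: iter k (br (gen b i)) y +
    br (gen b i) (br (gen (~~ b) i) (iter k (br (gen b i)) y)).
  rewrite [iter k.+1 _ _]/= (lie_jacobi lie) -{2}[b]negbK lie_genN eqxx.
  rewrite (lieZl lie) (weight_vector_iter b i k wy) wform_coroot.
  rewrite pairingD !pairingZ pairing_alpha A2 sgN scalerA -intrM -intrN.
  by congr (_%:~R *: _ + _); case: (b) => /=; ring.
elim: n => [|n IH].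
  by rewrite step /= y0 (lie0r lie) addr0 mul1r mulr0.
rewrite step IH (lieZr lie) -iterS -scalerDl -!intrN -intrD.
by congr (_%:~R *: _); rewrite -[n.+2%:Z]/(1 + n.+1)%N%:Z; lia.
Qed.

(** The exponent is 1 - a_ij. The resulting vector is killed by all opposite generators, so it
    vanishes as an extremal vector. For the i-th one this holds because the factor c + n of the sl_2
    formula is a_ij - a_ij. *)
Lemma serre b i j : i != j -> exists n, iter n (br (gen b i)) (gen b j) = 0.
Proof.
move=> ij; have [A2 Aneg Azero] := gcmA.
have [n en] : exists n : nat, A i j = - n%:Z.
  by have := Aneg i j ij; exists `|A i j|%N; lia.
exists n.+1; have wj := weight_vector_gen b j.
apply: (extremal_vector_eq0 (b := b) (weight_vector_iter b i n.+1 wj)).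
- move=> k; rewrite !mxE; case: (k == j); case: (k == i); case: (b);
    rewrite /=; lia.
- apply/eqP => /matrixP /(_ j 0); rewrite !mxE !eqxx eq_sym (negPf ij) /=.
  by case: (b); rewrite ?mulr0 ?mulr1.
move=> k; have [->|ki] := eqVneq k i.
  rewrite (sl2_iter n wj); last by rewrite -{2}[b]negbK lie_genN (negPf ij).
  rewrite pairingZ pairing_alpha mulrA sgK mul1r en addNr mulr0.
  by rewrite oppr0 scale0r.
have -> : br (gen (~~ b) k) (iter n.+1 (br (gen b i)) (gen b j)) =
    iter n.+1 (br (gen b i)) (br (gen (~~ b) k) (gen b j)).
  elim: n.+1 => //= m <-; rewrite (lie_jacobi lie) -{2}[b]negbK lie_genN.
  by rewrite (negPf ki) (lie0l lie) add0r.
rewrite -{3}[b]negbK lie_genN; case: eqP => [->|_]; last exact: iter_lie0.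
rewrite iterSr (lieZr lie) lie_gen_h wformZ wform_alpha scalerA.
(* The j-th opposite generator leaves a multiple of ad(x_i)^n x_i, where x_i is [gen b i]. For n = 0
   its coefficient contains a_ji, which vanishes with a_ij; for n > 0 the bracket of x_i with itself
   appears. *)
case: n en => [/Azero Aji|n _].
  rewrite -wform_alpha wform_coroot pairing_alpha Aji.
  by rewrite mulr0 oppr0 mulr0 scale0r.
by rewrite iterSr (lieZr lie) (liexx lie) scaler0 iter_lie0.
Qed.

Lemma gen_ad_nilpotent b i x : exists n, iter n (br (gen b i)) x = 0.
Proof.
have lnh u : iter 2 (br (gen b i)) (h u) = 0.
  by rewrite /= lie_gen_h (lieZr lie) (liexx lie) scaler0.
move: x; apply: km_generated.
- exact: ad_nilpotent_subalgebra lie _.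
- by move=> u; exists 2.
move=> b' j; have [->|nb] := eqVneq b' b.
  have [->|ji] := eqVneq i j; last exact: serre.
  by exists 1%N; rewrite /= (liexx lie).
have -> : b' = ~~ b by case: (b) (b') nb => -[].
(* Three steps suffice on an opposite generator: into the Cartan subalgebra, then to a multiple of
   [gen b i], then to 0. *)
exists 3; rewrite iterSr lie_genN; case: eqP => _; last exact: iter_lie0.
rewrite -[X in iter _ _ X]addr0 (iter_lieZD lie) lnh.
by rewrite scaler0 add0r (iter_lie0 lie).
Qed.

(** Choose b so that the signed pairing is m >= 0, climb p steps to the end y of the string, then
    descend m + p steps. The net shift is -m steps, which is the reflection. *)
Lemma weight_vector_refl i a x : weight_vector a x -> x != 0 ->
  exists2 y, y != 0 & weight_vector (simple_refl A i *m a) y.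
Proof.
have [A2 _ _] := gcmA.
move=> wx x0; rewrite simple_reflE.
have [b [m em]] : exists b, exists m : nat, sg b * pairing A i a = m%:Z.
  have [le0|lt0] := lerP 0 (pairing A i a).
    by exists true, `|pairing A i a|%N; rewrite mul1r gez0_abs.
  by exists false, `|pairing A i a|%N; rewrite mulN1r ltz0_abs.
case: (ex_minnP (let: ex_intro n e := gen_ad_nilpotent b i x in
                 ex_intro (fun n => iter n (br (gen b i)) x == 0) n (introT eqP e))).
case=> [|p] px pmin; first by rewrite (negPf x0) in px.
pose y := iter p (br (gen b i)) x.
have y0 : y != 0 by apply/negP => /pmin; rewrite ltnn.
have wy := weight_vector_iter b i p wx; rewrite -/y in wy.
have ey : br (gen (~~ (~~ b)) i) y = 0 by rewrite negbK; apply/eqP.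
(* The signed pairing of the weight of y is m + 2p, so the sl_2 coefficient at step n contains n -
   (m + 2p), nonzero below that bound. *)
have nz n : (n <= m + p.*2)%N -> iter n (br (gen (~~ b) i)) y != 0.
  elim: n => // n IH le; apply/eqP => e.
  have := sl2_iter n wy ey; rewrite e (lie0r lie) => /esym/eqP.
  rewrite scaler_eq0 (negPf (IH (ltnW le))) orbF oppr_eq0 => /eqP.
  move/(@intr_inj_char0 _ 0)/eqP; rewrite mulf_eq0 /=.
  rewrite pairingD !pairingZ pairing_alpha A2.
  rewrite mulrDr sgN mulNr em; move: em le; case: (b) => /=; lia.
exists (iter (m + p) (br (gen (~~ b) i)) y); first by apply: nz; lia.
have := weight_vector_iter (~~ b) i (m + p) wy.
rewrite -addrA -scalerN; congr (weight_vector (a + _) _).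
apply/matrixP => k l; rewrite !mxE sgN PoszD -em.
by case: (b) => /=; ring.
Qed.
End KacMoody.

(** * Stability of the cone Q^+_im under the Weyl group *)

Section ImaginaryRoots.
Variables (F : fieldType) (r : nat) (A : 'M[int]_r).
Hypothesis charF0 : [pchar F] =i pred0.
Hypothesis gcmA : is_gcm A.

(** s_i a is again a weight, so it has a sign. Were it negative, a would be a multiple of alpha_i;
    the only such positive weight is alpha_i, which is real. *)
Lemma pos_imag_refl i a : pos_imag A F a ->
  exists2 a', pos_imag A F a' & toQ a' = simple_refl A i *m toQ a.
Proof.
move=> [[a0 [g [x [x0 wx]]]] nr].
have [y y0 wy] := weight_vector_refl charF0 gcmA i wx x0.
have sa : nonneg (simple_refl A i *m toQ a).
  have [//|neg] := weight_vector_sign charF0 wy y0.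
  have e : toQ a = (a i 0)%:Z *: delta_mx i 0.
    apply/matrixP => k l; rewrite (ord1 l) !mxE.
    have [->|ki] := eqVneq k i; first by rewrite /= mulr1.
    have := neg k; rewrite simple_reflE !mxE (negPf ki) /= !mulr0; lia.
  have a1 : (a i 0)%:Z = 1.
    rewrite e in wx a0; have [b] := weight_vector_alpha charF0 wx x0 a0.
    by move/matrixP/(_ i 0); rewrite !mxE !eqxx; case: b => /=; lia.
  by case: nr; rewrite e a1 scale1r; apply: real_root_alpha.
exists (map_mx absz (simple_refl A i *m toQ a)); last exact: toQ_abs.
rewrite /pos_imag /= toQ_abs //; split.
  split; last by exists g, y.
  apply: contra_neq a0 => /(congr1 (mulmx (simple_refl A i))).
  by rewrite mulmxA simple_refl_sq // mul1mx mulmx0.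
move=> /(real_rootM (weyl_refl A i)).
by rewrite mulmxA simple_refl_sq // mul1mx.
Qed.

Lemma pos_imag_weyl w a : weyl A w -> pos_imag A F a -> nonneg (w *m toQ a).
Proof.
move=> [s _ <-] ia.
suff [a' _ <-] : exists2 a', pos_imag A F a' & toQ a' = weyl_word A s *m toQ a.
  exact: nonneg_toQ.
elim: s => [|i s [a' ia' e]] /=; first by exists a; rewrite ?mul1mx.
have [a'' ia'' e''] := pos_imag_refl i ia'.
by exists a''; rewrite // e'' e mulmxA.
Qed.

Lemma Qim_weyl w l : weyl A w -> Qim A F l -> nonneg (w *m toQ l).
Proof.
move=> ww [s sP ->]; elim: s sP => [|a s IH] sP i.
  by rewrite big_nil toQ0 mulmx0 mxE.
rewrite big_cons toQD mulmxDr mxE addr_ge0 //.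
  by apply: pos_imag_weyl => //; apply: sP; rewrite mem_head.
by apply: IH => b bs; apply: sP; rewrite inE bs orbT.
Qed.

(** A real root has -alpha_i in its W-orbit, which the orbit of an element of Q^+_im avoids. *)
Lemma Qim_not_real l : Qim A F l -> ~ pos_real A l.
Proof.
move=> il [w ww [i e]].
have := Qim_weyl (weylM (weyl_refl A i) (weylV gcmA ww)) il.
rewrite e -mulmxA mulKmx ?(weyl_unit gcmA) // simple_refl_alpha //.
by move=> /(_ i); rewrite !mxE !eqxx.
Qed.
End ImaginaryRoots.

(** * Filtrations of rings of formal series *)

(** Stated abstractly because two instances are needed: height for products over roots, total degree
    in t and e for sums over W. Together [filt_all] and [filtM] make each level absorb
    multiplication. *)
Record filtration (T : comNzRingType) (K : nat -> T -> Prop) : Prop :=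
  Filtration {
  filt_all : forall x, K 0%N x;
  filt0 : forall n, K n 0;
  filtD : forall n x y, K n x -> K n y -> K n (x + y);
  filtM : forall n m x y, K n x -> K m y -> K (n + m)%N (x * y);
  filt_leq : forall n m x, (n <= m)%N -> K m x -> K n x
}.

Section Filtration.
Variables (T : comUnitRingType) (K : nat -> T -> Prop).
Hypothesis Kf : filtration K.
Implicit Types (n : nat) (x y : T).

Lemma filt_mull n x y : K n y -> K n (x * y).
Proof. exact: filtM (filt_all Kf x). Qed.

Lemma filt_mulr n x y : K n x -> K n (x * y).
Proof. by rewrite mulrC; apply: filt_mull. Qed.

Lemma filtN n x : K n x -> K n (- x).
Proof. by rewrite -mulN1r; apply: filt_mull. Qed.

Lemma filtB n x y : K n x -> K n y -> K n (x - y).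
Proof. by move=> Kx /filtN; apply: filtD. Qed.

Lemma filt_exp k x : K 1%N x -> K k (x ^+ k).
Proof.
move=> Kx; elim: k => [|k IH]; first exact: filt_all.
by rewrite exprS; apply: (filtM Kf Kx IH).
Qed.

Lemma filt_sum (I : Type) (s : seq I) (P : pred I) (f : I -> T) n :
  (forall i, P i -> K n (f i)) -> K n (\sum_(i <- s | P i) f i).
Proof. by move=> h; elim/big_ind: _ => //; [exact: filt0|exact: filtD]. Qed.

Lemma filt1M n x y : K n (x - 1) -> K n (y - 1) -> K n (x * y - 1).
Proof.
move=> Kx Ky; rewrite (_ : _ - _ = x * (y - 1) + (x - 1)); last by ring.
by apply: filtD => //; apply: filt_mull.
Qed.

Lemma filt1V n x : x \is a GRing.unit -> K n (x - 1) -> K n (x^-1 - 1).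
Proof.
move=> ux Kx; rewrite (_ : _ - _ = - (x^-1 * (x - 1))).
  by apply: filtN; apply: filt_mull.
by rewrite mulrBr mulVr // mulr1 opprB.
Qed.

Lemma filt1X n x k : K n (x - 1) -> K n (x ^+ k - 1).
Proof.
move=> Kx; elim: k => [|k IH]; first by rewrite subrr; apply: filt0.
by rewrite exprS; apply: filt1M.
Qed.

Lemma filt1Xz n x (z : int) :
  x \is a GRing.unit -> K n (x - 1) -> K n (x ^ z - 1).
Proof.
move=> ux Kx; case: z => k; first exact: filt1X.
by rewrite NegzE -exprnN; apply: filt1V; [rewrite unitrX|apply: filt1X].
Qed.

Lemma filt1_prod (I : Type) (s : seq I) (P : pred I) (f : I -> T) n :
  (forall i, P i -> K n (f i - 1)) -> K n (\prod_(i <- s | P i) f i - 1).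
Proof.
move=> h; elim/big_ind: _ => //; last by move=> x y; exact: filt1M.
by rewrite subrr; apply: filt0.
Qed.

Lemma filt1_fsbig (I : choiceType) (S : set I) (f : I -> T) n :
  finite_set S -> (forall i, S i -> K n (f i - 1)) ->
  K n (\big[*%R/1]_(i \in S) f i - 1).
Proof.
move=> fS h; rewrite fsbig_finite // big_seq; apply: filt1_prod => i.
by rewrite in_fset_set // inE; apply: h.
Qed.

End Filtration.

Section Height.
Variable n : nat.
Implicit Types l m : 'cV[nat]_n.

Lemma htD l m : ht (l + m) = (ht l + ht m)%N.
Proof. by rewrite /ht -big_split; apply: eq_bigr => i _; rewrite mxE. Qed.

Lemma ht0 : ht (0 : 'cV[nat]_n) = 0%N.
Proof. by rewrite /ht big1 // => i _; rewrite mxE. Qed.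

Lemma ht_eq0 l : (ht l == 0%N) = (l == 0).
Proof.
apply/eqP/eqP => [e|->]; last exact: ht0.
apply/matrixP => i j; rewrite (ord1 j) mxE.
have : (l i 0%R <= ht l)%N by rewrite /ht (bigD1 i) //= leq_addr.
by rewrite e leqn0 => /eqP.
Qed.

Lemma ht_gt0 l : l != 0 -> (0 < ht l)%N.
Proof. by rewrite lt0n ht_eq0. Qed.

Lemma finite_ht N : finite_set [set l : 'cV[nat]_n | (ht l < N)%N].
Proof.
apply: (@sub_finite_set _ _ (range (@box_emb n N))); last exact: finite_image.
move=> l /= lN; have [|x <-] := @box_embK n N l; last by exists x.
move=> i; apply: leq_trans (ltnW lN); by rewrite /ht (bigD1 i) //= leq_addr.
Qed.

Lemma finite_ht_sub (S : set 'cV[nat]_n) N :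
  (forall l, S l -> (ht l < N)%N) -> finite_set S.
Proof. by move=> h; apply: sub_finite_set (finite_ht N). Qed.

End Height.

(** * Formal series filtered by height *)

Section FpsFiltration.
Variables (R : comNzRingType) (n : nat).
Local Notation T := (fps R n).
Implicit Types (a b : T) (l m : 'cV[nat]_n).

Lemma fps_coefD a b l : coef (a + b) l = coef a l + coef b l.
Proof. by []. Qed.

Lemma fps_coefN a l : coef (- a) l = - coef a l.
Proof. by []. Qed.

Lemma fps_coef0 l : coef (0 : T) l = 0.
Proof. by rewrite /= if_same. Qed.

Lemma fps_coef1 l : coef (1 : T) l = (l == 0)%:R.
Proof. by rewrite /=; case: (l == 0). Qed.

Lemma fps_coef_sum (I : Type) (s : seq I) (P : pred I) (f : I -> T) l :
  coef (\sum_(i <- s | P i) f i) l = \sum_(i <- s | P i) coef (f i) l.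
Proof.
by elim/big_rec2: _ => [|i x y _ <-]; [exact: fps_coef0|rewrite fps_coefD].
Qed.

Lemma fps_coefMn a l k : coef (a *+ k) l = coef a l *+ k.
Proof. by elim: k => [|k IH]; rewrite ?fps_coef0 // !mulrS fps_coefD IH. Qed.

Lemma fps_coefMz a l (z : int) : coef (a *~ z) l = coef a l *~ z.
Proof.
by case: z => k; rewrite ?NegzE ?mulrNz ?fps_coefN -!pmulrn !fps_coefMn.
Qed.

Lemma coefM_ind (P : R -> Prop) a b l : P 0 ->
  (forall x y, P x -> P y -> P (x + y)) ->
  (forall p q, p + q = l -> P (coef a p * coef b q)) -> P (coef (a * b) l).
Proof.
move=> P0 PD PM; have [N lN] := in_box_ex l.
rewrite [coef _ _](fps_mul_box _ _ lN).
elim/big_ind: _ => // x _; elim/big_ind: _ => // y _.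
by case: eqP => [/PM|].
Qed.

Lemma coefM_mon a c m l :
  coef (a * mon c m) (l + m) = coef a l * c.
Proof.
rewrite /= (fsbigE [:: (l, m)]) //=.
- by rewrite big_cons big_nil addr0 ifT ?eqxx // inE.
- by move=> p; rewrite /= inE => /eqP ->.
move=> [p q] /= e; rewrite inE; case: (q =P m) => [eq|]; last by rewrite mulr0.
case/eqP; congr (_, _) => //; apply/matrixP => i j.
by move/matrixP/(_ i j): e; rewrite eq !mxE; apply: addIn.
Qed.

Lemma coefM_mon0 a c l : coef (a * mon c 0) l = coef a l * c.
Proof. by rewrite -[l in LHS]addr0 coefM_mon. Qed.

Lemma monM c d l m : mon c l * mon d m = mon (c * d) (l + m) :> T.
Proof.
apply: fpsP => k; have [->|kl] := eqVneq k (l + m).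
  by rewrite coefM_mon /= !eqxx.
rewrite /= (negPf kl) fsbig1 // => -[p q] /= e.
case: eqP => [pl|]; last by rewrite mul0r.
case: eqP => [qm|]; last by rewrite mulr0.
by rewrite -e pl qm eqxx in kl.
Qed.

(** Gives e^l degree [ht l] on top of a filtration of the coefficients. The subtraction is
    truncated: above height j the condition is level 0, which is everything. *)
Definition fps_filt (K : nat -> R -> Prop) j a : Prop :=
  forall l, K (j - ht l)%N (coef a l).

Lemma fps_filtration K : filtration K -> filtration (fps_filt K).
Proof.
move=> Kf; split.
- by move=> a l; rewrite sub0n; apply: (filt_all Kf).
- by move=> j l; rewrite fps_coef0; apply: (filt0 Kf).
- by move=> j a b Ka Kb l; apply: (filtD Kf).
- move=> i j a b Ka Kb l; apply: coefM_ind.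
  + exact: (filt0 Kf).
  + exact: (filtD Kf).
  move=> p q <-; apply: (filt_leq Kf _ (filtM Kf (Ka p) (Kb q))).
  by rewrite htD; lia.
move=> i j a ij Ka l; apply: (filt_leq Kf _ (Ka l)).
exact: leq_sub2r.
Qed.

Definition discrete_filt j (x : R) : Prop := (0 < j)%N -> x = 0.

Lemma discrete_filtration : filtration discrete_filt.
Proof.
split=> //.
- by move=> j x y jx jy j0; rewrite jx ?jy ?addr0.
- move=> i j x y ix jy; rewrite /discrete_filt addn_gt0 => /orP [i0|j0].
    by rewrite ix ?mul0r.
  by rewrite jy ?mulr0.
by move=> i j x ij jx i0; apply: jx; apply: leq_trans ij.
Qed.

Definition hfilt : nat -> T -> Prop := fps_filt discrete_filt.

Lemma hfiltration : filtration hfilt.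
Proof. exact: fps_filtration discrete_filtration. Qed.

Lemma hfiltP j a : hfilt j a <-> forall l, (ht l < j)%N -> coef a l = 0.
Proof.
split=> h l; first by move=> lj; apply: h; rewrite subn_gt0.
by rewrite /discrete_filt subn_gt0; apply: h.
Qed.

Lemma hfilt_coef j a b l : hfilt j (a - b) -> (ht l < j)%N ->
  coef a l = coef b l.
Proof.
by move=> /hfiltP h /h /eqP; rewrite fps_coefD fps_coefN subr_eq0 => /eqP.
Qed.

Lemma hfilt_eq a b : (forall j, hfilt j (a - b)) -> a = b.
Proof. by move=> h; apply: fpsP => l; apply: hfilt_coef (h (ht l).+1) _. Qed.

Lemma hfilt_mon c l : hfilt (ht l) (mon c l).
Proof.
by apply/hfiltP => k kl /=; case: eqP => // e; rewrite e ltnn in kl.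
Qed.

(** When a has no constant term, a^k starts at height k, so the coefficient at l of the full
    geometric series is already that of this partial sum. *)
Definition geometric a : T :=
  Fps (fun l => coef (\sum_(k < (ht l).+1) a ^+ k) l).

Lemma geometricP a : hfilt 1 a -> (1 - a) * geometric a = 1.
Proof.
move=> a1; apply: hfilt_eq => N.
pose S := \sum_(k < N) a ^+ k.
have gS : hfilt N (geometric a - S).
  apply/hfiltP => l lN; set S0 := \sum_(k < (ht l).+1) a ^+ k.
  pose S1 := \sum_((ht l).+1 <= k < N) a ^+ k.
  have -> : S = S0 + S1.
    rewrite /S /S0 -!(big_mkord xpredT (fun k => a ^+ k)).
    exact: big_cat_nat.
  have /hfiltP S10 : hfilt (ht l).+1 S1.
    rewrite /S1 big_nat; apply: (filt_sum hfiltration) => k /andP [lk _].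
    exact: (filt_leq hfiltration lk (filt_exp hfiltration k a1)).
  by rewrite fps_coefD fps_coefN fps_coefD S10 // addr0 subrr.
have -> : (1 - a) * geometric a - 1 = (1 - a) * (geometric a - S) - a ^+ N.
  have -> : a ^+ N = 1 + (a - 1) * S by rewrite -subrX1 addrC subrK.
  ring.
apply: (filtB hfiltration); last exact: (filt_exp hfiltration).
exact: (filt_mull hfiltration).
Qed.

Lemma fps_unit_one a : hfilt 1 (a - 1) -> a \is a GRing.unit.
Proof.
move=> a1; apply/unitrPr; exists (geometric (1 - a)).
have := @geometricP (1 - a); rewrite opprB addrCA subrr addr0; apply.
by rewrite -opprB; apply: (filtN hfiltration).
Qed.

Lemma fps_inv_geometric a : hfilt 1 a -> (1 - a)^-1 = geometric a.
Proof. by move=> /geometricP /mulr1_eq. Qed.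

Lemma one_sub_mon N c l : l != 0 -> (N <= ht l)%N -> hfilt N (1 - mon c l - 1).
Proof.
move=> l0 Nl; rewrite addrAC subrr add0r; apply: (filtN hfiltration).
exact: (filt_leq hfiltration Nl (@hfilt_mon c l)).
Qed.

Lemma one_sub_mon_unit c l : l != 0 -> (1 - mon c l : T) \is a GRing.unit.
Proof.
by move=> l0; apply: fps_unit_one; apply: one_sub_mon; rewrite ?ht_gt0.
Qed.

Definition supp_in (S : set 'cV[nat]_n) a : Prop :=
  forall l, ~ S l -> coef a l = 0.

Section SuppIn.
Variable S : set 'cV[nat]_n.
Hypotheses (S0 : S 0) (SD : forall l m, S l -> S m -> S (l + m)).

Lemma supp_inD a b : supp_in S a -> supp_in S b -> supp_in S (a + b).
Proof. by move=> Sa Sb l Sl; rewrite fps_coefD Sa // Sb // addr0. Qed.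

Lemma supp_inN a : supp_in S a -> supp_in S (- a).
Proof. by move=> Sa l Sl; rewrite fps_coefN Sa // oppr0. Qed.

Lemma supp_in_mon c l : S l -> supp_in S (mon c l).
Proof. by move=> Sl k Sk /=; case: eqP => // e; rewrite e in Sk. Qed.

Lemma supp_in1 : supp_in S 1.
Proof. exact: supp_in_mon. Qed.

Lemma supp_inM a b : supp_in S a -> supp_in S b -> supp_in S (a * b).
Proof.
move=> Sa Sb l Sl; apply: (coefM_ind (P := fun x => x = 0)) => //.
  by move=> x y -> ->; apply: addr0.
move=> p q e.
have [Sp|/Sa ->] := pselect (S p); last exact: mul0r.
have [Sq|/Sb ->] := pselect (S q); last exact: mulr0.
by case: Sl; rewrite -e; apply: SD.
Qed.

Lemma supp_in_prod (I : eqType) (s : seq I) (f : I -> T) :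
  (forall i, i \in s -> supp_in S (f i)) -> supp_in S (\prod_(i <- s) f i).
Proof.
move=> h; rewrite big_seq; elim/big_ind: _ => //.
  exact: supp_in1.
exact: supp_inM.
Qed.

Lemma supp_in_inv a : hfilt 1 a -> supp_in S a -> supp_in S (1 - a)^-1.
Proof.
move=> a1 Sa l Sl; rewrite fps_inv_geometric //= fps_coef_sum big1 // => k _.
have Sk (j : nat) : supp_in S (a ^+ j).
  by elim: j => [|j IH]; [exact: supp_in1|rewrite exprS; apply: supp_inM].
exact: Sk.
Qed.
End SuppIn.

(* Modulo height 2N, multiplication of series congruent to 1 modulo height N is
   addition of their nonconstant parts. *)
Lemma coefM_one N a b l : hfilt N (a - 1) -> hfilt N (b - 1) ->
  l != 0 -> (ht l <= N)%N -> coef (a * b) l = coef a l + coef b l.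
Proof.
move=> Ka Kb l0 lN; have N0 : (0 < N)%N := leq_trans (ht_gt0 l0) lN.
rewrite (_ : a * b = (a - 1) * (b - 1) + a + b - 1); last by ring.
have /hfiltP := filtM hfiltration Ka Kb => h.
by rewrite !fps_coefD fps_coefN h ?fps_coef1 ?(negPf l0) ?add0r ?subr0 //; lia.
Qed.

Lemma coefV_one N a l : hfilt N (a - 1) ->
  l != 0 -> (ht l <= N)%N -> coef a^-1 l = - coef a l.
Proof.
move=> Ka l0 lN; have N0 : (0 < N)%N := leq_trans (ht_gt0 l0) lN.
have ua : a \is a GRing.unit.
  by apply: fps_unit_one; apply: (filt_leq hfiltration N0 Ka).
have := coefM_one Ka (filt1V hfiltration ua Ka) l0 lN.
rewrite mulrV // fps_coef1 (negPf l0) => /esym/eqP.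
by rewrite addrC addr_eq0 => /eqP.
Qed.

Lemma coefX_one N a k l : hfilt N (a - 1) ->
  l != 0 -> (ht l <= N)%N -> coef (a ^+ k) l = coef a l *+ k.
Proof.
move=> Ka l0 lN; elim: k => [|k IH]; first by rewrite fps_coef1 (negPf l0).
by rewrite exprS mulrS (coefM_one Ka (filt1X hfiltration k Ka) l0 lN) IH.
Qed.

Lemma coefXz_one N a (z : int) l : hfilt N (a - 1) ->
  l != 0 -> (ht l <= N)%N -> coef (a ^ z) l = coef a l *~ z.
Proof.
move=> Ka l0 lN; case: z => k; first exact: (coefX_one _ Ka).
rewrite NegzE -exprnN mulrNz.
by rewrite (coefV_one (filt1X hfiltration _ Ka) l0 lN) (coefX_one _ Ka).
Qed.

Lemma coef_prod_one N (I : Type) (s : seq I) (P : pred I) (f : I -> T) l :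
  (forall i, P i -> hfilt N (f i - 1)) -> l != 0 -> (ht l <= N)%N ->
  coef (\prod_(i <- s | P i) f i) l = \sum_(i <- s | P i) coef (f i) l.
Proof.
move=> Kf l0 lN; elim: s => [|i s IH].
  by rewrite !big_nil fps_coef1 (negPf l0).
rewrite !big_cons -IH; case: ifP => // Pi; apply: (coefM_one (Kf i Pi) _ l0 lN).
exact: (filt1_prod hfiltration).
Qed.

Lemma coef_fsbig_one N (I : choiceType) (S : set I) (f : I -> T) l :
  finite_set S -> (forall i, S i -> hfilt N (f i - 1)) ->
  l != 0 -> (ht l <= N)%N ->
  coef (\big[*%R/1]_(i \in S) f i) l = \sum_(i \in S) coef (f i) l.
Proof.
move=> fS Kf l0 lN; rewrite !fsbig_finite // big_seq [RHS]big_seq.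
apply: (coef_prod_one _ _ l0 lN) => i.
by rewrite in_fset_set // inE; apply: Kf.
Qed.

Lemma fps_lim_coef (u : nat -> T) l c :
  (exists N, forall k, (N <= k)%N -> coef (u k) l = c) ->
  coef (fps_lim u) l = c.
Proof.
move=> [N uN] /=; apply: xget_unique; first by exists N.
move=> d [M uM]; rewrite -(uM (maxn N M)) ?leq_maxr //.
by rewrite uN ?leq_maxl.
Qed.

Lemma fps_lim_unique (u : nat -> T) a :
  (forall N, exists M, forall k, (M <= k)%N -> hfilt N (u k - a)) ->
  fps_lim u = a.
Proof.
move=> h; apply: fpsP => l; apply: fps_lim_coef.
have [M uM] := h (ht l).+1; exists M => k /uM e.
exact: hfilt_coef e _.
Qed.

Lemma fps_lim_filt (u : nat -> T) :
  (forall N k, (N <= k)%N -> hfilt N (u k - u N)) ->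
  forall N, hfilt N (fps_lim u - u N).
Proof.
move=> h N; apply/hfiltP => l lN; rewrite fps_coefD fps_coefN.
rewrite (@fps_lim_coef _ _ (coef (u N) l)) ?subrr //; exists N => k Nk.
exact: hfilt_coef (h N k Nk) lN.
Qed.
End FpsFiltration.

(** * Euler products and their coefficients of leading height *)

Section EulerProducts.
Variables (R : comNzRingType) (r : nat) (t : R).
Implicit Types (S : set 'cV[nat]_r) (m : 'cV[nat]_r -> {poly int}).
Implicit Types l : 'cV[nat]_r.
Local Notation hf := (@hfiltration R r).

Definition euler_range S N :=
  [set l : 'cV[nat]_r | [/\ S l, l != 0 & (ht l < N)%N]].

Lemma euler_range_finite S N : finite_set (euler_range S N).
Proof. by apply: (@finite_ht_sub _ _ N) => l []. Qed.

Lemma euler_factor_one l p N : l != 0 -> (N <= ht l)%N ->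
  hfilt N (euler_factor t l p - 1).
Proof.
move=> l0 Nl; apply: (filt1_prod hf) => i _.
by apply: (filt1Xz hf); [exact: one_sub_mon_unit|exact: one_sub_mon].
Qed.

Lemma euler_factor_unit l p : l != 0 -> euler_factor t l p \is a GRing.unit.
Proof.
by move=> l0; apply: fps_unit_one; apply: euler_factor_one; rewrite ?ht_gt0.
Qed.

Lemma euler_factor0 l : euler_factor t l 0 = 1.
Proof. by rewrite /euler_factor size_poly0 big_ord0. Qed.

Lemma euler_factorN l p : l != 0 ->
  euler_factor t l (- p) = (euler_factor t l p)^-1.
Proof.
move=> l0; rewrite /euler_factor size_polyN -prodrV; last first.
  by move=> i _; rewrite unitrXz // one_sub_mon_unit.
by apply: eq_bigr => i _; rewrite coefN -invr_expz.
Qed.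

Lemma euler_truncE S m N : euler_trunc t S m N =
  \big[*%R/1]_(l \in euler_range S N) euler_factor t l (m l).
Proof. by []. Qed.

Lemma eq_euler_trunc S m m' N :
  (forall l, S l -> l != 0 -> (ht l < N)%N -> m l = m' l) ->
  euler_trunc t S m N = euler_trunc t S m' N.
Proof.
move=> e; apply: eq_fsbigr => l; rewrite inE => -[Sl l0 lN].
by rewrite e.
Qed.

Lemma eq_euler_prod S m m' : (forall l, S l -> l != 0 -> m l = m' l) ->
  euler_prod t S m = euler_prod t S m'.
Proof.
move=> e; rewrite /euler_prod; congr fps_lim; apply/funext => N.
by apply: eq_euler_trunc => l Sl l0 _; apply: e.
Qed.

Lemma euler_trunc_one S m N : hfilt 1 (euler_trunc t S m N - 1).
Proof.
apply: (filt1_fsbig hf); first exact: euler_range_finite.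
by move=> l [_ l0 _]; apply: euler_factor_one; rewrite ?ht_gt0.
Qed.

Lemma euler_trunc_leq S m N k : (N <= k)%N -> euler_trunc t S m k =
  euler_trunc t S m N *
  \big[*%R/1]_(l \in euler_range S k `&` ~` [set l | (ht l < N)%N])
     euler_factor t l (m l).
Proof.
move=> Nk; rewrite !euler_truncE.
rewrite (fsbigID [set l | (ht l < N)%N]); last exact: euler_range_finite.
rewrite [X in \big[_/_]_(l \in X) _](_ : _ `&` _ = euler_range S N) //.
apply/seteqP; split=> l /=; first by move=> [[? ? _] ?].
by move=> [? ? lN]; do !split=> //; apply: leq_trans Nk.
Qed.

Lemma euler_trunc_cong S m N k : (N <= k)%N ->
  hfilt N (euler_trunc t S m k - euler_trunc t S m N).
Proof.
move=> Nk; rewrite (euler_trunc_leq _ _ Nk).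
rewrite -{2}[euler_trunc t S m N]mulr1 -mulrBr.
apply: (filt_mull hf); apply: (filt1_fsbig hf).
  by apply: finite_setIl; apply: euler_range_finite.
move=> l [[_ l0 _] /negP]; rewrite -leqNgt => Nl.
exact: euler_factor_one.
Qed.

Lemma euler_prod_cong S m N : hfilt N (euler_prod t S m - euler_trunc t S m N).
Proof. by apply: fps_lim_filt => *; apply: euler_trunc_cong. Qed.

Lemma euler_prod_one S m : hfilt 1 (euler_prod t S m - 1).
Proof.
rewrite -(subrK (euler_trunc t S m 1) (euler_prod t S m)) -addrA.
apply: (filtD hf); first exact: euler_prod_cong.
exact: euler_trunc_one.
Qed.

(** At the height of l only the linear term -p_i t^i e^l of each power (1 - t^i e^l)^(p_i)
    survives. *)
Lemma coef_euler_factor l p k : l != 0 -> ht k = ht l ->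
  coef (euler_factor t l p) k =
  if k == l then - (\sum_(i < size p) t ^+ i *~ p`_i) else 0.
Proof.
move=> l0 kl; have k0 : k != 0 by rewrite -ht_eq0 kl ht_eq0.
rewrite (@coef_prod_one _ _ (ht l)) ?kl //; last first.
  by move=> i _; apply: (filt1Xz hf); [exact: one_sub_mon_unit|exact: one_sub_mon].
rewrite (eq_bigr (fun i : 'I_(size p) =>
    - (if k == l then t ^+ i else 0) *~ p`_i)); last first.
  move=> i _; rewrite (@coefXz_one _ _ (ht l)) ?kl //; last exact: one_sub_mon.
  by rewrite fps_coefD fps_coefN fps_coef1 (negPf k0) add0r.
case: eqP => _; last by rewrite big1 // => i _; rewrite oppr0 mul0rz.
by rewrite -sumrN; apply: eq_bigr => i _; rewrite mulNrz.
Qed.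

Lemma coef_euler_truncS m l : l != 0 ->
  coef (euler_trunc t [set: _] m (ht l).+1) l =
  coef (euler_trunc t [set: _] m (ht l)) l
  - \sum_(i < size (m l)) t ^+ i *~ (m l)`_i.
Proof.
move=> l0; have lpos := ht_gt0 l0.
rewrite (euler_trunc_leq _ _ (leqnSn (ht l))).
set S := _ `&` _; set G := \big[_/_]_(_ \in S) _; set E := euler_trunc _ _ _ _.
have SP k : S k <-> k != 0 /\ ht k = ht l.
  rewrite /S /euler_range /=; split.
    by move=> [[_ k0 kl] /negP nk]; split=> //; lia.
  by move=> [k0 kl]; split; [split=> //; lia|apply/negP; lia].
have fS : finite_set S by apply: finite_setIl; apply: euler_range_finite.
have G1 : hfilt (ht l) (G - 1).
  apply: (filt1_fsbig hf) => // k /SP [k0 kl].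
  by apply: euler_factor_one; rewrite ?kl.
(* G - 1 starts at height [ht l] and E - 1 at height 1, so their product does not reach l. *)
have -> : coef (E * G) l = coef E l + coef G l.
  rewrite (_ : E * G = (E - 1) * (G - 1) + E + G - 1); last by ring.
  have /hfiltP h := filtM hf (euler_trunc_one [set: _] m (ht l)) G1.
  rewrite !fps_coefD fps_coefN h ?fps_coef1 ?(negPf l0) ?add0r ?subr0 //.
congr (_ + _); rewrite /G (@coef_fsbig_one _ _ (ht l)) //; last first.
  by move=> k /SP [k0 kl]; apply: euler_factor_one; rewrite ?kl.
have Sl : S l by apply/SP.
rewrite (fsbigD1 l) // coef_euler_factor // eqxx fsbig1 /= ?addr0 //.
move=> k [/SP [k0 kl] /eqP nkl]; rewrite coef_euler_factor //.
by rewrite eq_sym (negPf nkl).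
Qed.

Lemma coef_euler_prod m l : l != 0 ->
  coef (euler_prod t [set: _] m) l =
  coef (euler_trunc t [set: _] m (ht l)) l
  - \sum_(i < size (m l)) t ^+ i *~ (m l)`_i.
Proof.
move=> l0; rewrite -coef_euler_truncS //.
apply: (@hfilt_coef _ _ (ht l).+1) => //; exact: euler_prod_cong.
Qed.

Lemma euler_trunc_inv S m N :
  euler_trunc t S (fun l => - m l) N * euler_trunc t S m N = 1.
Proof.
rewrite !euler_truncE -fsbig_split; last exact: euler_range_finite.
apply: fsbig1 => l [_ l0 _].
by rewrite /= euler_factorN // mulVr // euler_factor_unit.
Qed.

End EulerProducts.

(** * The correction factor *)

Section FpsMap.
Variables (R S : comNzRingType) (f : {rmorphism R -> S}) (n : nat).

Definition fps_map (a : fps R n) : fps S n := Fps (fun l => f (coef a l)).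

Fact fps_map_is_zmod_morphism : zmod_morphism fps_map.
Proof. by move=> a b; apply: fpsP => l /=; rewrite rmorphB. Qed.

Lemma fps_map_mon c l : fps_map (mon c l) = mon (f c) l.
Proof. by apply: fpsP => k /=; case: ifP => _; rewrite ?rmorph0. Qed.

Fact fps_map_is_monoid_morphism : monoid_morphism fps_map.
Proof.
split=> [|a b]; first by rewrite fps_map_mon rmorph1.
apply: fpsP => l; have [N lN] := in_box_ex l.
rewrite [RHS](fps_mul_box _ _ lN).
transitivity (f (coef (fps_mul a b) l)) => //.
rewrite (fps_mul_box _ _ lN) rmorph_sum; apply: eq_bigr => x _.
rewrite rmorph_sum; apply: eq_bigr => y _ /=.
by case: ifP => _; rewrite ?rmorph0 // rmorphM.
Qed.

HB.instance Definition _ :=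
  GRing.isZmodMorphism.Build (fps R n) (fps S n) fps_map
    fps_map_is_zmod_morphism.
HB.instance Definition _ :=
  GRing.isMonoidMorphism.Build (fps R n) (fps S n) fps_map
    fps_map_is_monoid_morphism.
End FpsMap.

(** The multiplicities and the recursion live over Z[t], the sum over W over Z[[t]]; this injective
    map transports the final identity. *)
Definition poly_fps (p : {poly int}) : fps int 1 := (map_poly intr p).[tvar].

Fact poly_fps_is_zmod_morphism : zmod_morphism poly_fps.
Proof. by move=> p q; rewrite /poly_fps rmorphB hornerD hornerN. Qed.

Fact poly_fps_is_monoid_morphism : monoid_morphism poly_fps.
Proof.
by split=> [|p q]; rewrite /poly_fps ?rmorph1 ?hornerC // rmorphM hornerM.
Qed.

HB.instance Definition _ := GRing.isZmodMorphism.Build {poly int} (fps int 1)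
  poly_fps poly_fps_is_zmod_morphism.
HB.instance Definition _ := GRing.isMonoidMorphism.Build {poly int} (fps int 1)
  poly_fps poly_fps_is_monoid_morphism.

Lemma poly_fpsX : poly_fps 'X = tvar.
Proof. by rewrite /poly_fps map_polyX hornerX. Qed.

Lemma poly_fpsE p : poly_fps p = \sum_(i < size p) tvar ^+ i *~ p`_i.
Proof.
rewrite /poly_fps (@horner_coef_wide _ (size p)) ?size_poly //.
by apply: eq_bigr => i _; rewrite coef_map /= mulrzl.
Qed.

Lemma tvarX k : tvar ^+ k = mon 1 (const_mx k).
Proof.
elim: k => [|k IH]; last rewrite exprS IH monM mulr1.
  by congr (mon 1 _); apply/matrixP => i j; rewrite !mxE.
by congr (mon 1 _); apply/matrixP => i j; rewrite !mxE.
Qed.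

Lemma coef_poly_fps p k : coef (poly_fps p) (const_mx k) = p`_k.
Proof.
rewrite poly_fpsE fps_coef_sum.
rewrite (eq_bigr (fun i : 'I_(size p) => if (k == i :> nat) then p`_i else 0)).
  have [kp|kp] := ltnP k (size p).
    rewrite (bigD1 (Ordinal kp)) //= eqxx big1 ?addr0 // => i /eqP ik.
    by case: eqP => // e; case: ik; apply: val_inj.
  rewrite nth_default // big1 // => i _; case: eqP => // e.
  by rewrite e leqNgt ltn_ord in kp.
move=> i _; rewrite fps_coefMz tvarX /=.
have -> : (const_mx k == const_mx (i : nat) :> 'cV[nat]_1) = (k == i :> nat).
  apply/eqP/eqP => [/matrixP /(_ 0 0)|->] //; by rewrite !mxE.
by case: eqP => _; rewrite ?mul0rz // -[in RHS](intz p`_i).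
Qed.

Lemma poly_fps_inj : injective poly_fps.
Proof. by move=> p q e; apply/polyP => k; rewrite -!coef_poly_fps e. Qed.

Lemma euler_factor_map r (l : 'cV[nat]_r) p : l != 0 ->
  fps_map poly_fps (euler_factor 'X l p) = euler_factor tvar l p.
Proof.
move=> l0; rewrite /euler_factor rmorph_prod; apply: eq_bigr => i _.
have em : fps_map poly_fps (mon ('X ^+ i) l) = mon (tvar ^+ i) l.
  by rewrite fps_map_mon -poly_fpsX; congr (mon _ _); apply: rmorphXn.
have e : fps_map poly_fps (1 - mon ('X ^+ i) l) = 1 - mon (tvar ^+ i) l.
  rewrite -em; transitivity (fps_map poly_fps (1 : fps _ r) -
                          fps_map poly_fps (mon ('X ^+ i) l)).
    exact: rmorphB.
  congr (_ - _); exact: rmorph1.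
rewrite -e; apply: rmorphXz; exact: one_sub_mon_unit.
Qed.

Lemma euler_trunc_map r (S : set 'cV[nat]_r) m N :
  fps_map poly_fps (euler_trunc 'X S m N) = euler_trunc tvar S m N.
Proof.
have fS := euler_range_finite S N.
rewrite !euler_truncE !fsbig_finite // rmorph_prod; apply: eq_big_seq => l.
rewrite in_fset_set // inE => -[_ l0 _]; exact: euler_factor_map.
Qed.

Lemma euler_factor_1subX r (l : 'cV[nat]_r) : l != 0 ->
  euler_factor tvar l (1 - 'X) = (1 - mon 1 l) / (1 - mon tvar l).
Proof.
move=> l0; have sz : size (1 - 'X : {poly int}) = 2%N.
  by rewrite -opprB size_polyN -polyC1 size_XsubC.
rewrite /euler_factor sz.
rewrite -(big_mkord xpredT (fun n => (1 - mon (tvar ^+ n) l) ^ (1 - 'X)`_n)).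
rewrite big_ltn // big_nat1 expr0 expr1.
have -> : (1 - 'X : {poly int})`_0 = 1 by rewrite coefB coef1 coefX subr0.
have -> : (1 - 'X : {poly int})`_1 = -1 by rewrite coefB coef1 coefX sub0r.
by rewrite expr1z.
Qed.

Lemma mulr_div_cancel (T : comUnitRingType) (x y z : T) :
  x \is a GRing.unit -> x / y * (z / x) = z / y.
Proof. by move=> ux; rewrite mulrC mulrA divrK. Qed.

Lemma subr_mulV (T : comUnitRingType) (x y z : T) :
  x \is a GRing.unit -> z - x^-1 * (y * z) = x^-1 * z * (x - y).
Proof.
by move=> ux; rewrite mulrBr -mulrA [z * x]mulrC mulKr // -mulrA [y * z]mulrC.
Qed.

(** * The sum over the Weyl group *)

Section CorrectionFactor.
Variables (r : nat) (A : 'M[int]_r).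
Hypothesis gcmA : is_gcm A.
Local Notation series := (fps (fps int 1) r).
Implicit Types (w : 'M[int]_r) (a l : 'cV[nat]_r).

(* filtration of Z[[t]][[Q^+]] by total degree: t^k e^l has degree k + ht l *)
Definition tfilt : nat -> series -> Prop := fps_filt (@hfilt int 1).

Lemma tfiltration : filtration tfilt.
Proof. exact: fps_filtration (hfiltration _ _). Qed.

Lemma tfiltP n (x : series) :
  tfilt n x <-> forall l k, (ht k + ht l < n)%N -> coef (coef x l) k = 0.
Proof.
split=> [h l k kl|h l].
  by have /hfiltP := h l; apply; lia.
by apply/hfiltP => k kl; apply: h; lia.
Qed.

Lemma tfilt_eq (x y : series) : (forall n, tfilt n (x - y)) -> x = y.
Proof.
move=> h; apply: fpsP => l; apply: fpsP => k.
have /tfiltP/(_ l k (ltnSn _)) := h (ht k + ht l).+1.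
by rewrite !fps_coefD !fps_coefN => /eqP; rewrite subr_eq0 => /eqP.
Qed.

(* w a or - w a, whichever is positive *)
Definition weyl_abs w a : 'cV[nat]_r := map_mx absz (w *m toQ a).

Lemma weyl_absP w a : weyl A w -> pos_real A a ->
  pos_real A (weyl_abs w a) /\
  toQ (weyl_abs w a) = if `[< nonneg (w *m toQ a) >] then w *m toQ a
                       else - (w *m toQ a).
Proof.
move=> ww ra; have rw := real_rootM ww ra.
have e : toQ (weyl_abs w a) = if `[< nonneg (w *m toQ a) >] then w *m toQ a
                       else - (w *m toQ a).
  case: asboolP => [/toQ_abs //|nn].
  have [//|np] := real_root_sign gcmA rw.
  rewrite -[RHS]toQ_abs //; congr toQ.
  by apply/matrixP => i j; rewrite !mxE abszN.
split=> //; rewrite /pos_real /= e; case: asboolP => // _.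
exact: real_rootN.
Qed.

Lemma weyl_absK w a : weyl A w -> pos_real A a ->
  weyl_abs (invmx w) (weyl_abs w a) = a.
Proof.
move=> ww ra; have [_ e] := weyl_absP ww ra; have uw := weyl_unit gcmA ww.
rewrite {1}/weyl_abs e; case: asboolP => _; rewrite ?mulmxN mulKmx //.
  exact: toQK.
by rewrite -[RHS]toQK; apply/matrixP => i j; rewrite !mxE abszN.
Qed.

Definition inv_factor a : series := (mon tvar 0 - mon 1 a) / (1 - mon tvar a).

(** The factor of Delta_re / Delta_t,re at the positive one of w a and - w a cancels the w-image of
    the factor at a if w keeps a positive; otherwise it leaves the inversion factor. *)
Lemma weyl_binom_quot w a : weyl A w -> pos_real A a ->
  euler_factor tvar (weyl_abs w a) (1 - 'X) *
    (weyl_binom w 1 a / weyl_binom w 0 a)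
  = if `[< nonneg (w *m toQ a) >] then 1 else inv_factor (weyl_abs w a).
Proof.
move=> ww ra; have [rb _] := weyl_absP ww ra; have b0 := pos_real_neq0 gcmA rb.
have u1 : (1 - mon 1 (weyl_abs w a) : series) \is a GRing.unit.
  exact: one_sub_mon_unit.
have ut := one_sub_mon_unit tvar b0.
rewrite euler_factor_1subX // /weyl_binom -/(weyl_abs w a) expr0 expr1.
have -> : [forall i, 0 <= (w *m toQ a) i 0] = `[< nonneg (w *m toQ a) >].
  by apply/forallP/asboolP.
case: asboolP => _; last exact: mulr_div_cancel.
by apply: etrans (divrr ut); apply: mulr_div_cancel.
Qed.

Lemma finite_bounded (T : choiceType) (S : set T) (f : T -> nat) :
  finite_set S -> exists B, forall x, S x -> (f x < B)%N.
Proof.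
move=> /finite_seqP [s ->]; exists (\max_(x <- s) f x).+1 => x xs.
by rewrite ltnS; apply: leq_bigmax_seq.
Qed.

(** This is Delta_re / Delta_t,re, the multiplicity 1 - t being constant on real roots. *)
Definition real_prod : series := euler_prod tvar (pos_real A) (fun=> 1 - 'X).

Lemma real_prod_unit : real_prod \is a GRing.unit.
Proof. by apply: fps_unit_one; apply: euler_prod_one. Qed.

(** Reindexing a finite product along a -> |w a| gives an exact identity P Q = Psi, where P collects
    the real factors over the image set Y. Enlarging the product brings P close to [real_prod]. *)
Lemma weyl_quotE w (s : seq 'cV[nat]_r) : weyl A w -> uniq s ->
  (forall a, a \in s <-> pos_real A a /\ ~ nonneg (invmx w *m toQ a)) ->
  real_prod * weyl_quot A w = \prod_(a <- s) inv_factor a.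
Proof.
move=> ww us sP; set Psi := \prod_(a <- s) _.
have hf := hfiltration (fps int 1) r.
suff -> : weyl_quot A w = real_prod^-1 * Psi.
  by rewrite mulVKr // real_prod_unit.
apply: fps_lim_unique => M.
(* B bounds the heights of the preimages under a -> |w a| of all inversions and of everything below
   height M. For N >= B the set Y thus contains the inversions and all positive real roots of height
   below M. *)
have [B Bs] : exists B, forall a, (a \in s \/ (ht a < M)%N) ->
    (ht (weyl_abs (invmx w) a) < B)%N.
  apply: (@finite_bounded _ [set a | a \in s \/ (ht a < M)%N]).
  rewrite (_ : [set _ | _] = [set` s] `|` [set a | (ht a < M)%N]) //.
  by rewrite finite_setU; split; [exact: finite_seq|exact: finite_ht].
exists B => N BN; set X := [set a | _]; set Q := \big[_/_]_(_ \in X) _.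
have fX : finite_set X by apply: (@finite_ht_sub _ _ N) => a [].
pose Y := weyl_abs w @` X.
have injX : set_inj X (weyl_abs w).
  move=> a b; rewrite !inE => -[ra _] [rb _] e.
  by rewrite -(weyl_absK ww ra) e weyl_absK.
have fY : finite_set Y by apply: finite_image.
have Yreal a : Y a -> pos_real A a.
  by move=> [b [rb _] <-]; have [] := weyl_absP ww rb.
have inY a : pos_real A a -> (a \in s \/ (ht a < M)%N) -> Y a.
  move=> ra /Bs aB; have wi := weylV gcmA ww.
  exists (weyl_abs (invmx w) a).
    split; first by have [] := weyl_absP wi ra.
    exact: leq_trans aB BN.
  by rewrite -{1}(invmxK w) weyl_absK.
pose fac a := euler_factor tvar a (1 - 'X).
set P := \big[*%R/1]_(a \in Y) fac a.
have PQ : P * Q = Psi.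
  pose G a := if a \in s then inv_factor a else 1.
  have -> : P = \big[*%R/1]_(a \in X) fac (weyl_abs w a) by apply: fsbig_image.
  rewrite -fsbig_split //; transitivity (\big[*%R/1]_(a \in X) G (weyl_abs w a)).
    apply: eq_fsbigr => a; rewrite inE => -[ra _].
    rewrite /= weyl_binom_quot //; have [rb e] := weyl_absP ww ra.
    rewrite /G; have uw := weyl_unit gcmA ww.
    case: asboolP e => [p e|np e]; case: ifPn => // /negP ins.
      have /sP [_ []] : weyl_abs w a \in s by apply: contrapT.
      by rewrite e mulKmx //; apply: nonneg_toQ.
    case: ins; apply/sP; split=> //.
    rewrite e mulmxN mulKmx // => na; have := nonneg_anti (nonneg_toQ a) na.
    by apply/eqP; apply: real_root_neq0 ra.
  rewrite -fsbig_image // -/Y (fsbigE s) //.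
  - rewrite big_seq_cond [RHS]big_seq; apply: eq_big => a.
      rewrite andb_idr // => ins; rewrite inE; apply: inY; last by left.
      by have [] := (sP a).1 ins.
    by rewrite /G => /andP [->].
  - by move=> a ins /=; apply: inY; [have [] := (sP a).1 ins|left].
  by move=> a _ /negPf ns; rewrite /G ns.
have P1 : hfilt 1 (P - 1).
  apply: (filt1_fsbig hf) => // a /Yreal ra.
  have a0 := pos_real_neq0 gcmA ra.
  by apply: euler_factor_one => //; apply: ht_gt0.
have PE : hfilt M (P - real_prod).
  have := @euler_prod_cong _ _ tvar (pos_real A) (fun=> 1 - 'X) M.
  rewrite -/real_prod; set E := euler_trunc _ _ _ _ => EM.
  rewrite (_ : P - _ = (P - E) - (real_prod - E)); last by ring.
  apply: (filtB hf) => //.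
  rewrite /P (fsbigID [set a | (ht a < M)%N]) //=.
  have -> : Y `&` [set a | (ht a < M)%N] = euler_range (pos_real A) M.
    apply/seteqP; split=> a /=.
      by move=> [/Yreal ra aM]; split=> //; apply: (pos_real_neq0 gcmA).
    by move=> [ra _ aM]; split=> //; apply: inY => //; right.
  rewrite -/(euler_trunc tvar (pos_real A) (fun=> 1 - 'X) M) -/E.
  rewrite -{2}[E]mulr1 -mulrBr; apply: (filt_mull hf).
  apply: (filt1_fsbig hf); first exact: finite_setIl.
  move=> a [/Yreal ra /negP aM]; rewrite -leqNgt in aM.
  by apply: euler_factor_one => //; apply: (pos_real_neq0 gcmA).
have uP : P \is a GRing.unit by apply: fps_unit_one.
have -> : Q - real_prod^-1 * Psi = (real_prod^-1 * Q) * (real_prod - P).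
  by rewrite -PQ; apply: subr_mulV; apply: real_prod_unit.
by apply: (filt_mull hf); rewrite -opprB; apply: (filtN hf).
Qed.

Lemma inv_factor_tfilt a : a != 0 -> tfilt 1 (inv_factor a).
Proof.
move=> a0; apply: (filt_mulr tfiltration); apply: (filtB tfiltration).
  apply/tfiltP => l k; case: l => l /=; case: ifP => _; last by rewrite fps_coef0.
  rewrite ltnS leqn0 addn_eq0 => /andP [+ _]; rewrite ht_eq0 => /eqP ->.
  by rewrite /= ; case: eqP => // /matrixP /(_ 0 0); rewrite !mxE.
apply/tfiltP => l k; rewrite /=; case: eqP => [->|_]; last by rewrite fps_coef0.
by have := ht_gt0 a0; lia.
Qed.

Lemma weyl_quot_spec w : weyl A w -> exists s : seq 'cV[nat]_r,
  [/\ real_prod * weyl_quot A w = \prod_(a <- s) inv_factor a,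
    size s = weyl_len A w &
    forall a, a \in s -> pos_real A a /\ ~ nonneg (invmx w *m toQ a)].
Proof.
move=> ww; have [s [us sz sP]] := inversions gcmA ww.
by exists s; split=> //; [exact: weyl_quotE|move=> a /sP].
Qed.

(** One factor of positive total degree per inversion. This makes only finitely many w contribute to
    each t^k e^l. *)
Lemma weyl_quot_tfilt w : weyl A w -> tfilt (weyl_len A w) (weyl_quot A w).
Proof.
move=> ww; have [s [e <- sP]] := weyl_quot_spec ww.
rewrite -(mulKr real_prod_unit (weyl_quot A w)) e; apply: (filt_mull tfiltration).
rewrite big_seq_cond; elim: s {e} sP => [|a s IH] sP.
  exact: filt_all tfiltration _.
rewrite -big_seq_cond big_cons; apply: (filtM tfiltration (n := 1)).
  apply: inv_factor_tfilt; apply: (pos_real_neq0 gcmA).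
  by have [] := sP a (mem_head _ _).
by rewrite big_seq_cond; apply: IH => b bs; apply: sP; rewrite inE bs orbT.
Qed.

Lemma weyl_sum_cong (x : 'M[int]_r -> series) n :
  (forall w, weyl A w -> tfilt (weyl_len A w) (x w)) ->
  forall s, uniq s ->
  (forall w, w \in s <-> weyl A w /\ (weyl_len A w < n)%N) ->
  tfilt n (weyl_sum A x - \sum_(w <- s) x w).
Proof.
move=> xl s us sP; apply/tfiltP => l k kl.
rewrite !fps_coefD !fps_coefN !fps_coef_sum /=.
apply/eqP; rewrite subr_eq0; apply/eqP.
rewrite (fsbigE s) //; last 2 first.
- by move=> w /sP [].
- move=> w ww ws; have /tfiltP := xl w ww; apply.
  apply: leq_trans kl _; rewrite leqNgt; apply/negP => lt.
  by case/negP: ws; apply/sP.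
rewrite big_seq_cond [RHS]big_seq; apply: eq_bigl => w.
by rewrite andb_idr // => /sP [ww _]; rewrite inE.
Qed.

(** The sum over W may be infinite, so distributivity is checked modulo each total degree n, where
    the finitely many w of length below n suffice. *)
Lemma weyl_sum_mulr (x : 'M[int]_r -> series) (y : series) :
  (forall w, weyl A w -> tfilt (weyl_len A w) (x w)) ->
  y * weyl_sum A x = weyl_sum A (fun w => y * x w).
Proof.
move=> xl; apply: tfilt_eq => n; have [s0 s0P] := weyl_finite_len A n.
pose s := undup [seq w <- s0 | `[< weyl A w /\ (weyl_len A w < n)%N >]].
have us : uniq s by apply: undup_uniq.
have sP w : w \in s <-> weyl A w /\ (weyl_len A w < n)%N.
  rewrite mem_undup mem_filter; split; first by move=> /andP [/asboolP].
  by move=> [ww lw]; rewrite s0P // andbT; apply/asboolP.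
have h1 := weyl_sum_cong xl us sP.
have h2 : tfilt n (weyl_sum A (fun w => y * x w) - \sum_(w <- s) y * x w).
  apply: weyl_sum_cong => // w ww; apply: (filt_mull tfiltration); exact: xl.
rewrite (_ : _ - _ = y * (weyl_sum A x - \sum_(w <- s) x w) -
   (weyl_sum A (fun w => y * x w) - \sum_(w <- s) y * x w)).
  by apply: (filtB tfiltration) => //; apply: (filt_mull tfiltration).
rewrite -mulr_sumr; ring.
Qed.

Lemma coef_weyl_quot_Qim (F : fieldType) (charF0 : [pchar F] =i pred0) w l :
  weyl A w -> Qim A F l -> l != 0 -> coef (real_prod * weyl_quot A w) l = 0.
Proof.
move=> ww il l0; have [s [-> _ sP]] := weyl_quot_spec ww.
(* A submonoid of Q^+ containing 0 and all inversions of w, hence the support of every factor and of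
   their product. *)
pose S := [set l : 'cV[nat]_r | nonneg (- (invmx w *m toQ l))].
have S0 : S 0 by move=> i; rewrite toQ0 mulmx0 oppr0 mxE.
have SD a b : S a -> S b -> S (a + b).
  by move=> Sa Sb i; rewrite toQD mulmxDr opprD mxE addr_ge0.
have wi := weylV gcmA ww.
suff /(_ l) : supp_in S (\prod_(a <- s) inv_factor a).
  apply=> nl; have e := nonneg_anti (Qim_weyl charF0 gcmA wi il) nl.
  case/eqP: l0; apply: toQ_inj; rewrite toQ0 -[LHS]mul1mx.
  by rewrite -(mulmxV (weyl_unit gcmA ww)) -mulmxA e mulmx0.
apply: supp_in_prod => // a ain; have [ra na] := sP a ain.
have Sa : S a by have [] := real_root_sign gcmA (real_rootM wi ra).
have a0 := pos_real_neq0 gcmA ra.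
apply: supp_inM => //; first apply: supp_inD; last 2 first.
- by apply: supp_inN; apply: supp_in_mon.
- apply: supp_in_inv => //; last exact: supp_in_mon.
  exact: (filt_leq (hfiltration _ _) (ht_gt0 a0) (@hfilt_mon _ _ _ _)).
exact: supp_in_mon.
Qed.

(** P(t) involves no e^l, and only w = 1 contributes to its constant term 1. Being a unit, it can be
    cancelled from a vanishing coefficient. *)
Lemma poincareE :
  exists2 p : fps int 1, p \is a GRing.unit & poincare A = mon p 0.
Proof.
exists (coef (poincare A) 0).
  apply: fps_unit_one; apply/hfiltP => k; rewrite ltnS leqn0 ht_eq0 => /eqP ->.
  rewrite fps_coefD fps_coefN fps_coef1 eqxx.
  apply/eqP; rewrite subr_eq0; apply/eqP.
  rewrite /= (fsbigE [:: 1%:M]) //=.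
  - rewrite big_cons big_nil addr0 ifT; last by rewrite inE; apply: weyl1.
    by rewrite weyl_len1 expr0 eqxx fps_coef1 eqxx.
  - by move=> w; rewrite /= inE => /eqP ->; apply: weyl1.
  move=> w ww; rewrite inE => w1; rewrite eqxx tvarX /=; case: eqP => // e.
  case/eqP: w1; apply: (weyl_len0 ww).
  by move/matrixP/(_ 0 0): e; rewrite !mxE.
apply: fpsP => l; rewrite [RHS]/=; case: eqP => [->//|/eqP l0].
apply: fpsP => k; rewrite fps_coef0 /=; apply: fsbig1 => w _.
by rewrite (negPf l0) fps_coef0.
Qed.

(** * Vanishing on Q^+_im and the height recursion *)

Section TMultiplicities.
Variables (F : fieldType) (frakm : series) (m : 'cV[nat]_r -> {poly int}).
Hypothesis charF0 : [pchar F] =i pred0.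
Hypothesis frakmP : correction_factor A frakm.
Hypothesis mP : is_tmult A F frakm m.

Lemma euler_trunc_split N : euler_trunc tvar [set: _] m N =
  euler_trunc tvar (pos_real A) m N * euler_trunc tvar (Qim A F) m N.
Proof.
have [_ _ mrest] := mP.
rewrite [LHS]euler_truncE (fsbigID (pos_real A)); last first.
  exact: euler_range_finite.
rewrite [X in \big[_/_]_(l \in X) _](_ : _ `&` _ = euler_range (pos_real A) N);
  last first.
  by apply/seteqP; split=> l /=; [move=> [[_ ? ?] ?]|move=> [? ? ?]].
rewrite /= -euler_truncE; congr (_ * _); rewrite euler_truncE.
apply/esym/fsbig_widen.
  move=> l [il l0 lN]; split=> //; exact: Qim_not_real il.
move=> l [[[_ l0 lN] nr] /= nQ]; rewrite mrest ?euler_factor0 //.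
by move=> il; apply: nQ.
Qed.

(** At each truncation the factors over Q^+_im, taken with exponents m and -m, cancel and leave the
    real ones; the limits inherit the identity. *)
Lemma euler_prod_frakm : euler_prod tvar [set: _] m * frakm = real_prod.
Proof.
have [-> mreal _] := mP; apply: hfilt_eq => N.
have hf := hfiltration (fps int 1) r.
have := @euler_prod_cong _ _ tvar [set: _] m N.
have := @euler_prod_cong _ _ tvar (Qim A F) (fun l => - m l) N.
have := @euler_prod_cong _ _ tvar (pos_real A) (fun=> 1 - 'X) N.
rewrite -/real_prod.
have -> : euler_trunc tvar (pos_real A) (fun=> 1 - 'X) N =
    euler_trunc tvar [set: _] m N *
    euler_trunc tvar (Qim A F) (fun l => - m l) N.
  rewrite euler_trunc_split -mulrA [_ * euler_trunc _ _ (fun l => _) _]mulrC.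
  rewrite euler_trunc_inv mulr1; apply: eq_euler_trunc => l /mreal -> //.
move: (euler_prod _ _ _) (euler_prod _ _ _).
move: (euler_trunc _ _ _ _) (euler_trunc _ _ _ _).
move=> b d D B h1 h2 h3.
rewrite (_ : _ - _ = (D - d) * B + d * (B - b) - (real_prod - d * b)); last by ring.
apply: (filtB hf) => //; apply: (filtD hf); first exact: (filt_mulr hf).
exact: (filt_mull hf).
Qed.

Lemma coef_euler_prod_Qim l : Qim A F l -> l != 0 ->
  coef (euler_prod tvar [set: _] m) l = 0.
Proof.
move=> il l0; have [p up pE] := poincareE.
apply: (mulIr up); rewrite mul0r -coefM_mon0 -pE -frakmP mulrA euler_prod_frakm.
rewrite weyl_sum_mulr; last exact: weyl_quot_tfilt.
apply: fpsP => k; rewrite fps_coef0.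
apply: (@fsbig1 _ 0 +%R) => w ww.
by rewrite (coef_weyl_quot_Qim charF0 ww il l0) fps_coef0.
Qed.

Lemma tmult_coef l : l != 0 -> Qim A F l ->
  m l = coef (euler_trunc 'X [set: _] m (ht l)) l.
Proof.
move=> l0 il; apply: poly_fps_inj; apply/esym/eqP; rewrite -subr_eq0; apply/eqP.
rewrite [in X in _ - X]poly_fpsE -[RHS](coef_euler_prod_Qim il l0).
rewrite coef_euler_prod //.
by rewrite -euler_trunc_map.
Qed.

Lemma tmult_recE k l : (ht l <= k)%N -> l != 0 ->
  tmult_rec (pos_real A) (Qim A F) k l = m l.
Proof.
have [_ mreal mrest] := mP.
elim: k l => [|k IH] l lk l0; first by have := ht_gt0 l0; rewrite ltnNge lk.
rewrite /=; case: ifPn => [|/negP nr]; first by rewrite inE => /mreal.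
case: ifPn => [|/negP nQ]; rewrite ?inE in nr *.
  move=> il; rewrite (tmult_coef l0 il); congr (coef _ l).
  (* The truncation involves only heights below [ht l], for which the remaining k levels of
     recursion suffice. *)
  by apply: eq_euler_trunc => a _ a0 al; apply: IH => //; lia.
by rewrite inE in nQ; rewrite mrest.
Qed.
End TMultiplicities.
End CorrectionFactor.

Theorem mainTheorem4 (F : fieldType) (charF0 : [pchar F] =i pred0) (r : nat) :
  (forall (A : 'M[int]_r) (frakm : fps (fps int 1) r)
     (m : 'cV[nat]_r -> {poly int}),
     is_gcm A -> correction_factor A frakm -> is_tmult A F frakm m ->
     forall l : 'cV[nat]_r, l != 0 -> Qim A F l ->
       m l = coef (euler_trunc 'X [set: 'cV[nat]_r] m (ht l)) l)
  /\
  (exists Im : set 'cV[nat]_r -> set 'cV[nat]_r,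
     forall (A : 'M[int]_r) (frakm : fps (fps int 1) r)
       (m : 'cV[nat]_r -> {poly int}),
       is_gcm A -> correction_factor A frakm -> is_tmult A F frakm m ->
       let Re := pos_real A in
       let rec_m l := tmult_rec Re (Im Re) (ht l) l in
       [/\ Im Re = Qim A F,
           forall l : 'cV[nat]_r, l != 0 -> m l = rec_m l &
           frakm = euler_prod tvar (Im Re) (fun l => - rec_m l)]).
Proof.
split=> [A frakm m gcmA hA hm l l0 il|].
  exact: (tmult_coef gcmA charF0 hA hm).
(* Im must depend on Re alone, so it collects Q^+_im over all Cartan matrices with these positive
   real roots; by [pos_real_gcm_inj] there is at most one. *)
pose Im (Re : set 'cV[nat]_r) : set 'cV[nat]_r :=
  [set l | exists A, [/\ is_gcm A, pos_real A = Re & Qim A F l]].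
exists Im.
move=> A frakm m gcmA hA hm Re rec_m.
have ImE : Im Re = Qim A F.
  apply/seteqP; split=> [l [B [gcmB e]]|l il]; last by exists A.
  by rewrite (pos_real_gcm_inj gcmB gcmA e).
have recE l : l != 0 -> m l = rec_m l.
  by move=> l0; rewrite /rec_m ImE (tmult_recE gcmA charF0 hA hm).
split=> //; rewrite ImE; have [-> _ _] := hm.
by apply: eq_euler_prod => l _ l0; rewrite recE.
Qed.
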